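(* Let $T$ be a complete first-order theory in a language $L$ with monster model $\mathfrak{C}$, and let $\varphi(\overline{x}; \overline{y})$ be a partitioned $L$-formula. Then: (i) $\varphi$ is stable if and only if there exist $K<\omega$ and an $L$-formula $\psi(\overline{y}; \overline{z}_0, \dots, \overline{z}_{K-1})$ (with $\mathrm{lg}(\overline{z}_j)=\mathrm{lg}(\overline{y})$) such that for every indiscernible sequence $\langle \overline{b}_i : i \in I \rangle$ of $\mathrm{lg}(\overline{y})$-tuples with $|I| \ge 2$ and every $p(\overline{x}) \in S_\varphi(\{ \overline{b}_i : i \in I \})$, there exist $i_0, \dots, i_{K-1} \in I$ such that $\psi(\overline{y}; \overline{b}_{i_0}, \dots, \overline{b}_{i_{K-1}})$ defines $p(\overline{x})$. (ii) $\varphi$ is dependent if and only if there exist $K<\omega$ and an $L$-formula $\psi(\overline{y}; \overline{z}_0, \dots, \overline{z}_{K-1})$ such that for every finite indiscernible sequence $\langle \overline{b}_i : i < L' \rangle$ of $\mathrm{lg}(\overline{y})$-tuples with $L' \ge 2$ and every $p(\overline{x}) \in S_\varphi(\{ \overline{b}_i : i < L' \})$, there exist $i_0, \dots, i_{K-1} < L'$ such that $\psi(\overline{y}; \overline{b}_{i_0}, \dots, \overline{b}_{i_{K-1}})$ defines $p(\overline{x})$.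
   Context: Formulas are $\emptyset$-definable $L$-formulas. For a formula $\theta$, $\theta^1=\theta$ and $\theta^0=\neg\theta$. For a small set $B \subseteq \mathfrak{C}^{\mathrm{lg}(\overline{y})}$, a $\varphi$-type over $B$ is a maximal consistent set of formulas of the form $\varphi(\overline{x}; \overline{b})^t$ with $t<2$, $\overline{b} \in B$; its domain is $B$, and $S_\varphi(B)$ is the set of all $\varphi$-types over $B$. A formula $\psi(\overline{y})$ (possibly with parameters) defines a $\varphi$-type $p$ if for all $\overline{b} \in \mathrm{dom}(p)$: $\models \psi(\overline{b})$ iff $\varphi(\overline{x}; \overline{b}) \in p$. A set $B$ is $\varphi$-independent if for every $s: B \to 2$ the set $\{\varphi(\overline{x};\overline{b})^{s(\overline{b})} : \overline{b}\in B\}$ is consistent; $\varphi$ is dependent if there is a finite bound on the size of $\varphi$-independent sets. An indiscernible sequence indexed by a linear order $I$ is a sequence such that any two increasing $n$-tuples of its terms satisfy the same formulas, for all $n$.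
   Formalization: Indiscernible sequences are required to have pairwise distinct terms, i.e. constant sequences are excluded; for constant sequences the claim fails (infinite sets, φ: x=y, both x=b and x≠b are types over {b}). *)

(* Defs.v *)
From HB Require Import structures.
From mathcomp Require Import all_boot all_order.
From mathcomp Require Import boolp classical_sets functions cardinality.

Set Implicit Arguments.
Unset Strict Implicit.
Unset Printing Implicit Defensive.

Local Open Scope classical_set_scope.
Local Open Scope card_scope.

Record language := Language {
  fsym : Type;
  far : fsym -> nat;
  rsym : Type;
  rar : rsym -> nat
}.

(* The parameter V of [term] and [formula] is the type of free variables:
   a partitioned formula phi(x; y) with lg(x) = m and lg(y) = n is an element
   of [formula L ('I_m + 'I_n)], and an L-formula in variables V with
   parameters in a structure M is an element of [formula L (V + M)]. *)
Inductive term (L : language) (V : Type) : Type :=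
| Var of V
| App (f : fsym L) of ('I_(far f) -> term L V).

Inductive formula (L : language) (V : Type) : Type :=
| Ffalse
| Feq of term L V & term L V
| Frel (r : rsym L) of ('I_(rar r) -> term L V)
| Fnot of formula L V
| Fand of formula L V & formula L V
| Fex of formula L (option V). (* the bound variable is [None] *)

Arguments Var {L V} _.
Arguments App {L V} f _.
Arguments Ffalse {L V}.
Arguments Feq {L V} _ _.
Arguments Frel {L V} r _.
Arguments Fnot {L V} _.
Arguments Fand {L V} _ _.
Arguments Fex {L V} _.

Fixpoint tmap (L : language) (V W : Type) (h : V -> W) (t : term L V) : term L W :=
  match t with
  | Var v => Var (h v)
  | App f ts => App f (fun i => tmap h (ts i))
  end.

Fixpoint fmap (L : language) (V W : Type) (h : V -> W) (A : formula L V) :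
    formula L W :=
  match A with
  | Ffalse => Ffalse
  | Feq s t => Feq (tmap h s) (tmap h t)
  | Frel r ts => Frel r (fun i => tmap h (ts i))
  | Fnot A => Fnot (fmap h A)
  | Fand A B => Fand (fmap h A) (fmap h B)
  | Fex A => Fex (fmap (omap h) A)
  end.

Record structure (L : language) := Structure {
  carrier :> Type;
  fint : forall f : fsym L, ('I_(far f) -> carrier) -> carrier;
  rint : forall r : rsym L, ('I_(rar r) -> carrier) -> Prop;
  carrier_inhabited : inhabited carrier
}.

Fixpoint teval (L : language) (M : structure L) (V : Type) (v : V -> M)
    (t : term L V) : M :=
  match t with
  | Var x => v x
  | App f ts => fint (fun i => teval v (ts i))
  end.

Fixpoint sat (L : language) (M : structure L) (V : Type) (A : formula L V) :
    (V -> M) -> Prop :=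
  match A with
  | Ffalse => fun _ => False
  | Feq s t => fun v => teval v s = teval v t
  | Frel r ts => fun v => rint (fun i => teval v (ts i))
  | Fnot A => fun v => ~ sat A v
  | Fand A B => fun v => sat A v /\ sat B v
  | Fex A => fun v => exists c : M, sat A (fun o => oapp v c o)
  end.

Definition sumval (V W X : Type) (v : V -> X) (w : W -> X) (z : V + W) : X :=
  match z with inl x => v x | inr y => w y end.

(* [inst A b] is the formula A(x; b) with parameters b. *)
Definition inst (L : language) (M : structure L) (V W : Type)
    (A : formula L (V + W)) (b : W -> M) : formula L (V + M) :=
  fmap (sumval (@inl V M) (fun w => inr (b w))) A.

Definition psat (L : language) (M : structure L) (V : Type)
    (A : formula L (V + M)) (a : V -> M) : Prop :=
  sat A (sumval a id).

Definition fpow (L : language) (V : Type) (A : formula L V) (t : bool) :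
    formula L V :=
  if t then A else Fnot A.

Definition theory (L : language) := set (formula L void).

Definition models (L : language) (M : structure L) (T : theory L) :=
  forall A, T A -> sat A (of_void M).

Definition entails (L : language) (T : theory L) (A : formula L void) :=
  forall M : structure L, models M T -> sat A (of_void M).

Definition complete (L : language) (T : theory L) :=
  (exists M : structure L, models M T) /\
  (forall A, entails T A \/ entails T (Fnot A)).

(* Consistency with the elementary diagram of M, in its usual finitary form:
   every finite subset is satisfied by some tuple of M. *)
Definition consistent (L : language) (M : structure L) (V : Type)
    (p : set (formula L (V + M))) :=
  forall F : set (formula L (V + M)), finite_set F -> F `<=` p ->
    exists a : V -> M, forall A, F A -> psat A a.

Definition formulas_over (L : language) (M : structure L) (V : Type)
    (B : set M) : set (formula L (V + M)) :=
  [set inst A (fun b : {c : M | B c} => sval b) |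
    A in [set: formula L (V + {c : M | B c})]].

(* Cardinals are represented by types; [small kappa A] is |A| < kappa. *)
Definition small (kappa : Type) (T : Type) (A : set T) : Prop :=
  ~ ([set: kappa] #<= A).

Definition saturated (L : language) (kappa : Type) (M : structure L) :=
  forall (B : set M) (p : set (formula L (unit + M))),
    small kappa B -> p `<=` formulas_over B -> consistent p ->
    exists a : unit -> M, forall A, p A -> psat A a.

Definition elementary_on (L : language) (M : structure L) (B : set M)
    (h : M -> M) :=
  forall A : formula L {c : M | B c},
    sat A (fun b => sval b) <-> sat A (fun b => h (sval b)).

Definition automorphism (L : language) (M : structure L) (g : M -> M) :=
  [/\ bijective g,
      forall (f : fsym L) (a : 'I_(far f) -> M),
        g (fint a) = fint (fun i => g (a i)) &
      forall (r : rsym L) (a : 'I_(rar r) -> M),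
        rint a <-> rint (fun i => g (a i))].

Definition strongly_homogeneous (L : language) (kappa : Type)
    (M : structure L) :=
  forall (B : set M) (h : M -> M), small kappa B -> elementary_on B h ->
    exists2 g : M -> M, automorphism g & forall b, B b -> g b = h b.

(* The first conjunct is kappa > |L| + aleph_0. *)
Definition monster (L : language) (T : theory L) (kappa : Type)
    (C : structure L) :=
  [/\ small kappa [set: nat + (fsym L + rsym L)],
      models C T, saturated kappa C & strongly_homogeneous kappa C].

Section PartitionedFormula.
Variables (L : language) (C : structure L) (m n : nat).
Variable phi : formula L ('I_m + 'I_n).

(* phi does not have the order property. *)
Definition stable :=
  ~ exists (a : nat -> 'I_m -> C) (b : nat -> 'I_n -> C),
      forall i j : nat, sat phi (sumval (a i) (b j)) <-> (i < j)%N.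

Definition phi_independent (B : set ('I_n -> C)) :=
  forall s : ('I_n -> C) -> bool,
    consistent [set fpow (inst phi b) (s b) | b in B].

Definition dependent :=
  exists N : nat, forall B : set ('I_n -> C), phi_independent B -> B #<= `I_N.

Definition phi_formulas (B : set ('I_n -> C)) : set (formula L ('I_m + C)) :=
  [set A | exists2 b, B b & exists t : bool, A = fpow (inst phi b) t].

(* p \in S_phi(B) *)
Definition phi_type (B : set ('I_n -> C)) (p : set (formula L ('I_m + C))) :=
  [/\ p `<=` phi_formulas B, consistent p &
      forall q, q `<=` phi_formulas B -> consistent q -> p `<=` q -> q = p].

Definition defines (psi : formula L ('I_n + C)) (B : set ('I_n -> C))
    (p : set (formula L ('I_m + C))) :=
  forall b, B b -> (psat psi b <-> p (inst phi b)).

End PartitionedFormula.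

Definition indiscernible (L : language) (C : structure L) (n : nat)
    (d : Order.disp_t) (I : orderType d) (b : I -> 'I_n -> C) :=
  forall (k : nat) (s t : 'I_k -> I),
    (forall i j : 'I_k, (i < j)%N -> (s i < s j)%O) ->
    (forall i j : 'I_k, (i < j)%N -> (t i < t j)%O) ->
    forall A : formula L ('I_k * 'I_n),
      sat A (fun v => b (s v.1) v.2) <-> sat A (fun v => b (t v.1) v.2).

(* Main.v *)
(** Everything about phi-types over a sequence [b] is read off from patterns: a
    pattern [w] holds of [ys] when some [a] gives [phi(a, ys)] the truth values
    [w]. Patterns are definable, hence constant on increasing tuples of an
    indiscernible sequence.

    If phi has the order (or independence) property, realizing coheirs along a
    free ultrafilter turns a witness into an indiscernible one with the same
    patterns; in the stable case a second coheir sequence, reversed, is put on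
    top, which gives the index order [omega + omega^*]. Its middle cut defines a
    type that no formula with finitely many parameters can define, since the
    terms next to the cut are exchangeable over the parameters. In the dependent
    case an alternating type over [2 (K + 1)] terms is not definable with [K]
    parameters.

    Conversely, if phi is stable, a type over an indiscernible sequence has
    boundedly many positive or boundedly many negative instances, since long
    blocks of both kinds yield long orders. If phi is dependent and both kinds
    are numerous, some pattern becomes unrealizable after exchanging two
    adjacent truth values; this defines the order of the sequence except near
    its ends, and the type is a union of boundedly many intervals. *)

From HB Require Import structures.
From mathcomp Require Import all_boot all_order.
From mathcomp Require Import boolp classical_sets functions cardinality filter.
From mathcomp Require Import zify.
Require Import Defs.

Set Implicit Arguments.
Unset Strict Implicit.
Unset Printing Implicit Defensive.

Import Order.Theory.

Local Open Scope classical_set_scope.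
Local Open Scope card_scope.

(** * Formulas and satisfaction *)

Lemma tmap_comp (L : language) (V W X : Type) (g : V -> W) (h : W -> X)
  (t : term L V) : tmap h (tmap g t) = tmap (h \o g) t.
Proof. by elim: t => [//|f ts IH] /=; congr App; apply/funext => i. Qed.

Lemma fmap_comp (L : language) (V W X : Type) (g : V -> W) (h : W -> X)
  (A : formula L V) : fmap h (fmap g A) = fmap (h \o g) A.
Proof.
elim: A W X g h => {V} [V|V s t|V r ts|V A IH|V A IHA B IHB|V A IH] W X g h //=.
- by rewrite !tmap_comp.
- by congr Frel; apply/funext => i; rewrite tmap_comp.
- by rewrite IH.
- by rewrite IHA IHB.
- by rewrite IH; congr (Fex (fmap _ _)); apply/funext => -[].
Qed.

Lemma teval_tmap (L : language) (M : structure L) (V W : Type) (h : V -> W)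
  (v : W -> M) (t : term L V) : teval v (tmap h t) = teval (v \o h) t.
Proof. by elim: t => [//|f ts IH] /=; congr fint; apply/funext => i. Qed.

Lemma sat_fmap (L : language) (M : structure L) (V W : Type) (h : V -> W)
  (A : formula L V) (v : W -> M) : sat (fmap h A) v = sat A (v \o h).
Proof.
elim: A W h v => {V} [V|V s t|V r ts|V A IH|V A IHA B IHB|V A IH] W h v //=.
- by rewrite !teval_tmap.
- by congr rint; apply/funext => i; rewrite teval_tmap.
- by rewrite IH.
- by rewrite IHA IHB.
- congr (exists c, _); apply/funext => c; rewrite IH.
  by congr sat; apply/funext => -[].
Qed.

Lemma psat_inst (L : language) (M : structure L) (V W : Type)
  (A : formula L (V + W)) (b : W -> M) (a : V -> M) :
  psat (inst A b) a = sat A (sumval a b).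
Proof. by rewrite /psat sat_fmap; congr sat; apply/funext => -[]. Qed.

Lemma psat_fpow (L : language) (M : structure L) (V : Type)
  (A : formula L (V + M)) (t : bool) (a : V -> M) :
  psat (fpow A t) a <-> t = `[< psat A a >].
Proof.
rewrite /fpow; case: t; first by split=> [/asboolP ->|/esym/asboolP].
by split=> [/asboolPn/negbTE <-|/esym/negbT/asboolPn].
Qed.

(** [Fex] binds a single variable, so the block of [k] quantifiers is built by induction; [h] sends
    the first variable of the block to [None]. *)
Lemma definable_exists (L : language) (M : structure L) (k : nat) :
  forall (W : Type) (A : formula L (W + 'I_k)), exists B : formula L W,
    forall v : W -> M, sat B v <-> exists a, sat A (sumval v a).
Proof.
elim: k => [|k IH] W A.
  have o0 (i : 'I_0) : W by case: i.
  exists (fmap (sumval id o0) A) => v; rewrite sat_fmap.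
  have E (a : 'I_0 -> M) : v \o sumval id o0 = sumval v a.
    by apply/funext => -[//|[]].
  split=> [Av|[a]]; last by rewrite -E.
  by exists (v \o o0); rewrite -E.
pose h (x : W + 'I_k.+1) : option W + 'I_k :=
  match x with
  | inl w => inl (Some w)
  | inr i => oapp inr (inl None) (unlift ord0 i)
  end.
have [B HB] := IH _ (fmap h A).
exists (Fex B) => v /=; split=> [[c /HB[a]]|[a Aa]].
  rewrite sat_fmap => Aa; exists (fun i => oapp a c (unlift ord0 i)).
  suff <- : sumval (oapp v c) a \o h =
    sumval v (fun i => oapp a c (unlift ord0 i)) by [].
  by apply/funext => -[//|i] /=; case: (unlift ord0 i).
exists (a ord0); apply/HB; exists (a \o lift ord0); rewrite sat_fmap.
suff -> : sumval (oapp v (a ord0)) (a \o lift ord0) \o h = sumval v a by [].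
by apply/funext => -[//|i] /=; case: unliftP => [j|] ->.
Qed.

(** * Limits along an ultrafilter *)

Section Limits.
Variables (L : language) (kappa : Type) (C : structure L).
Hypothesis kappa_uncountable : small kappa [set: nat + (fsym L + rsym L)].
Hypothesis C_saturated : saturated kappa C.

Lemma small_countable (T : Type) (B : set T) : countable B -> small kappa B.
Proof.
move=> cB kB; apply: kappa_uncountable.
apply: card_le_trans kB (card_le_trans cB _).
pose f (i : nat) : nat + (fsym L + rsym L) := inl i.
have [_ natI] : range f #<= [set: nat] /\ [set: nat] #<= range f.
  by apply/card_eqPle/inj_card_eq => i j _ _ [].
exact: card_le_trans natI (subset_card_le (@subsetT _ _)).
Qed.

Lemma countable_range_sumval (V : Type) (X : countType) (c : V -> C) (f : X -> C) :
  countable (range c) -> countable (range (sumval c f)).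
Proof.
move=> cc; apply: (@sub_countable _ _ _ (range c `|` range f)); last first.
  rewrite -bigcup2E; apply: bigcup_countable => // -[|[|i]] _ //=.
  exact: card_le_trans (card_image_le _ _) (countableP _).
by apply: subset_card_le => _ [[v|y] _ <-]; [left; exists v|right; exists y].
Qed.

Variable U : set_system nat.
Hypothesis U_ultra : UltraFilter U.

Lemma ultra_not (P : nat -> Prop) :
  U [set N | ~ P N] <-> ~ U [set N | P N].
Proof.
split=> [UnP UP|nUP].
  by have /filter_ex[N []] : U ([set N | P N] `&` [set N | ~ P N]) by apply: filterI.
by have [/nUP|] := in_ultra_setVsetC [set N | P N] U_ultra.
Qed.

Lemma ultra_const (P : Prop) : U [set _ | P] <-> P.
Proof.
split=> [/filter_ex[]//|HP].
by apply: (@filterS _ _ _ setT); [|exact: filterT].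
Qed.

(** The type of [c] is the ultralimit of the types of the [e N]. Tuples of [C] itself thus play the
    part that elements of an ultrapower would play. *)
Definition is_limit (V : Type) (c : V -> C) (e : nat -> V -> C) :=
  forall A : formula L V, sat A c <-> U [set N | sat A (e N)].

Lemma is_limit_const (V : Type) (c : V -> C) : is_limit c (fun=> c).
Proof. by move=> A; rewrite ultra_const. Qed.

Lemma is_limit_comp (V W : Type) (h : V -> W) (c : W -> C) (e : nat -> W -> C) :
  is_limit c e -> is_limit (c \o h) (fun N => e N \o h).
Proof.
move=> ce A; have := ce (fmap h A); rewrite sat_fmap => ->.
by under eq_set do rewrite sat_fmap.
Qed.

(** Saturation realizes the limit type over [c]. A finite part of it follows from one formula [A]
    true at [U]-almost all [x N]; so [Fex A] holds at almost all [e N], hence at [c]. *)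
Lemma is_limit_extend (V : Type) (c : V -> C) (e : nat -> V -> C)
    (x : nat -> C) : countable (range c) -> is_limit c e ->
  exists c0, is_limit (oapp c c0) (fun N => oapp (e N) (x N)).
Proof.
move=> cc ce.
(* The new variable stays free as [inl tt]; the old ones become parameters from [c]. *)
pose g (o : option V) : unit + C := oapp (inr \o c) (inl tt) o.
pose p := [set fmap g A | A in [set A | U [set N | sat A (oapp (e N) (x N))]]].
have gE c0 (A : formula L (option V)) : psat (fmap g A) (fun=> c0) = sat A (oapp c c0).
  by rewrite /psat sat_fmap; congr sat; apply/funext => -[].
have [|F Ffin Fp|a pa] := @C_saturated (range c) p (small_countable cc).
- move=> _ [A _ <-].
  pose h (o : option V) : unit + {y : C | range c y} :=
    oapp (fun v => inr (exist _ (c v) (imageT c v))) (inl tt) o.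
  exists (fmap h A) => //; rewrite /inst fmap_comp.
  by congr Defs.fmap; apply/funext => -[].
- have /(@finite_seqP {classic (formula L (unit + C))})[s Fs] := Ffin.
  suff [A [UA AF]] : exists A : formula L (option V),
    U [set N | sat A (oapp (e N) (x N))] /\
    forall c0, sat A (oapp c c0) -> forall B, B \in s -> psat B (fun=> c0).
    have /ce[c0 Ac0] : U [set N | sat (Fex A) (e N)].
      by apply: filterS UA => N AN; exists (x N).
    by exists (fun=> c0) => B; rewrite Fs => /(AF _ Ac0).
  have : forall B, B \in s -> p B by move=> B Bs; apply: Fp; rewrite Fs.
  elim: s {Fs} => [_|B s IH sp].
    by exists (Fnot Ffalse); split => //; apply: filterS filterT => N _ [].
  have [A [UA AF]] := IH (fun B' B's => sp B' (mem_behead (s := B :: s) B's)).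
  have [A' UA' A'B] := sp B (mem_head _ _).
  exists (Fand A A'); split=> [|c0 [/= Ac0 A'c0] B']; first exact: filterI.
  by rewrite inE => /predU1P[->|/(AF _ Ac0)//]; rewrite -A'B gE.
exists (a tt) => A.
have E : (fun=> a tt) = a by apply/funext => -[].
have pA (B : formula L (option V)) : U [set N | sat B (oapp (e N) (x N))] ->
    sat B (oapp c (a tt)).
  by move=> UB; rewrite -gE E; apply: pa; exists B.
(* The limit type is complete because [U] is an ultrafilter, so realizing it gives an
   equivalence. *)
split=> [Aa|]; last exact: pA.
by apply: contrapT => /ultra_not/(pA (Fnot A)).
Qed.

(** The coordinates in [X] are chosen one by one in the order of their codes, each over a range that
    is still countable. A family with codes below [M] is settled at stage [M], hence the bound in
    the conclusion. *)
Lemma is_limit_extends (V : Type) (X : countType) (c : V -> C)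
    (e : nat -> V -> C) (x : nat -> X -> C) :
    countable (range c) -> is_limit c e ->
  exists c0 : X -> C, forall (Y : Type) (g : Y -> X) (M : nat),
    (forall y, pickle (g y) < M)%N ->
    is_limit (sumval c (c0 \o g)) (fun N => sumval (e N) (x N \o g)).
Proof.
move=> cc ce; have [z0] := carrier_inhabited C.
(* A number that decodes to no coordinate gets the filler [z0]. *)
pose x' N i := oapp (x N) z0 (unpickle i : option X).
pose Good k (f : nat -> C) :=
  is_limit (sumval c (fun i : 'I_k => f i))
           (fun N => sumval (e N) (fun i : 'I_k => x' N i)).
have Good0 : Good 0 (fun=> z0).
  have o (i : 'I_0) : V by case: i.
  have E (c1 : V -> C) c2 : c1 \o sumval id o = sumval c1 c2.
    by apply/funext => -[//|[]].
  have := is_limit_comp (sumval id o) ce; rewrite /Good (E _ (fun=> z0)).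
  suff -> : (fun N => e N \o sumval id o) =
    (fun N => sumval (e N) (fun i : 'I_0 => x' N i)) by [].
  by apply/funext => N; apply: E.
pose upd (f : nat -> C) k z i := if i == k then z else f i.
have step k f : exists z, Good k f -> Good k.+1 (upd f k z).
  have [Gf|] := pselect (Good k f); last by exists z0.
  have [|z Hz] := is_limit_extend (x' ^~ k) _ Gf.
    exact: countable_range_sumval.
  exists z => _.
  pose h (v : V + 'I_k.+1) : option (V + 'I_k) :=
    match v with inl v => Some (inl v) | inr i => omap inr (insub (val i)) end.
  have := is_limit_comp h Hz; rewrite /Good.
  have E (c1 : V -> C) (c2 : nat -> C) :
      oapp (sumval c1 (fun i : 'I_k => c2 i)) (c2 k) \o h =
      sumval c1 (fun i : 'I_k.+1 => c2 i).
    apply/funext => -[//|i] /=; case: insubP => [j _ /= -> //|/=].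
    rewrite -leqNgt => ki; congr c2; apply/eqP.
    by rewrite eqn_leq ki -ltnS ltn_ord.
  have -> : oapp (sumval c (fun i : 'I_k => f i)) z =
      oapp (sumval c (fun i : 'I_k => upd f k z i)) (upd f k z k).
    apply/funext => -[[//|i]|] /=; last by rewrite /upd eqxx.
    by rewrite /upd ltn_eqF.
  rewrite E; suff -> :
    (fun N => oapp (sumval (e N) (fun i : 'I_k => x' N i)) (x' N k) \o h) =
    (fun N => sumval (e N) (fun i : 'I_k.+1 => x' N i)) by [].
  by apply/funext => N; apply: (E _ (x' N)).
(* With [Good] as a premise, [choice] ranges over all partial assignments and the recursion [st]
   carries no proofs. *)
have /choice[nxt nxtP] : forall kf : nat * (nat -> C), exists z,
    Good kf.1 kf.2 -> Good kf.1.+1 (upd kf.2 kf.1 z) by move=> [k f]; apply: step.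
pose fix st k := if k is k'.+1 then upd (st k') k' (nxt (k', st k')) else fun=> z0.
have stG k : Good k (st k) by elim: k => // k /(nxtP (k, _)).
have stE k i : (i < k)%N -> st k i = st i.+1 i.
  elim: k => // k IH; rewrite ltnS leq_eqVlt => /predU1P[->//|ik].
  by rewrite -IH //= /upd ltn_eqF.
exists (fun q => st (pickle q).+1 (pickle q)) => Y g M gM.
pose h (v : V + Y) : V + 'I_M :=
  match v with inl v => inl v | inr y => inr (Ordinal (gM y)) end.
have := is_limit_comp h (stG M).
have -> : sumval c (fun i : 'I_M => st M i) \o h =
  sumval c ((fun q => st (pickle q).+1 (pickle q)) \o g).
  by apply/funext => -[//|y] /=; rewrite stE.
suff -> : (fun N => sumval (e N) (fun i : 'I_M => x' N i) \o h) =
  (fun N => sumval (e N) (x N \o g)) by [].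
apply/funext => N; apply/funext => -[//|y] /=; by rewrite /x' pickleK.
Qed.

End Limits.

Lemma map_nth_enum (T : Type) (y0 : T) (k : nat) (s : seq T) :
  size s = k -> [seq nth y0 s (val i) | i <- enum 'I_k] = s.
Proof.
by move=> <-; rewrite (map_comp (nth y0 s)) val_enum_ord -/(mkseq _ _) mkseq_nth.
Qed.

Lemma nth_map_enum (T : Type) (y0 : T) (k : nat) (f : 'I_k -> T) (i : 'I_k) :
  nth y0 (map f (enum 'I_k)) i = f i.
Proof. by rewrite (nth_map i) ?size_enum_ord // nth_ord_enum. Qed.

Lemma sorted_map_enum (d : Order.disp_t) (I : orderType d) (k : nat)
    (f : 'I_k -> I) : (forall i j : 'I_k, (i < j)%N -> (f i < f j)%O) ->
  sorted <%O (map f (enum 'I_k)).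
Proof.
move=> finc; apply: (homo_sorted (e := relpre val ltn)) => [i j /finc //|].
by rewrite -sorted_map val_enum_ord iota_ltn_sorted.
Qed.

(** * Relations on tuples *)

Section Relations.
Variables (L : language) (C : structure L) (m n : nat).
Variable phi : formula L ('I_m + 'I_n).
Notation tup := ('I_n -> C).

(** Definability without parameters, as a property of relations: closure properties can then be used
    without manipulating formulas. *)
Definition definable (W : Type) (D : (W -> tup) -> Prop) :=
  exists A : formula L (W * 'I_n),
    forall z : W -> tup, sat A (fun v => z v.1 v.2) <-> D z.

Lemma definable_ext (W : Type) (D E : (W -> tup) -> Prop) :
  (forall z, D z <-> E z) -> definable D -> definable E.
Proof. by move=> DE [A AD]; exists A => z; rewrite -DE. Qed.

Lemma definable_false (W : Type) : definable (fun _ : W -> tup => False).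
Proof. by exists Ffalse. Qed.

Lemma definable_not (W : Type) (D : (W -> tup) -> Prop) :
  definable D -> definable (fun z => ~ D z).
Proof. by move=> [A AD]; exists (Fnot A) => z /=; rewrite AD. Qed.

Lemma definable_and (W : Type) (D E : (W -> tup) -> Prop) :
  definable D -> definable E -> definable (fun z => D z /\ E z).
Proof. by move=> [A AD] [B BE]; exists (Fand A B) => z /=; rewrite AD BE. Qed.

Lemma definable_or (W : Type) (D E : (W -> tup) -> Prop) :
  definable D -> definable E -> definable (fun z => D z \/ E z).
Proof.
move=> dD dE.
have dnDE := definable_and (definable_not dD) (definable_not dE).
apply: (definable_ext _ (definable_not dnDE)).
by move=> z; rewrite not_andP !notK.
Qed.

Lemma definable_comp (W W' : Type) (h : W -> W') (D : (W -> tup) -> Prop) :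
  definable D -> definable (fun z => D (z \o h)).
Proof.
move=> [A AD]; exists (fmap (fun v => (h v.1, v.2)) A) => z.
by rewrite sat_fmap; apply: (AD (z \o h)).
Qed.

Lemma definable_eq (W : Type) (w w' : W) : definable (fun z => z w = z w').
Proof.
suff [A AD] : exists A : formula L (W * 'I_n), forall z : W -> tup,
    sat A (fun v => z v.1 v.2) <-> {in enum 'I_n, z w =1 z w'}.
  exists A => z; rewrite AD; split=> [E|->//].
  by apply/funext => i; apply: E; rewrite mem_enum.
elim: (enum 'I_n) => [|i s [A AD]]; first by exists (Fnot Ffalse) => z; split=> // _ [].
exists (Fand (Feq (Var (w, i)) (Var (w', i))) A) => z /=; rewrite AD.
split=> [[Ei Es] j|E].
  by rewrite inE => /predU1P[->|/Es].
by split=> [|j js]; apply: E; rewrite inE ?eqxx // js orbT.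
Qed.

Definition truth (a : 'I_m -> C) (y : tup) : bool := `[< sat phi (sumval a y) >].

Definition pattern (w : seq bool) (ys : seq tup) :=
  exists a, map (truth a) ys = w.

Lemma pattern_size w ys : pattern w ys -> size w = size ys.
Proof. by case=> a <-; rewrite size_map. Qed.

(** For fixed [a] the condition is a finite conjunction of instances of [phi] and of its negation;
    [definable_exists] then quantifies [a] away. *)
Lemma definable_pattern (W : Type) (w : seq bool) (xs : seq W) :
  definable (fun z => pattern w (map z xs)).
Proof.
suff [A AD] : exists A : formula L (W * 'I_n + 'I_m),
    forall (z : W -> tup) a,
      sat A (sumval (fun v => z v.1 v.2) a) <-> map (truth a) (map z xs) = w.
  have [B BA] := definable_exists C A.
  exists B => z; rewrite BA; split=> -[a]; exists a; exact/AD.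
elim: xs w => [|x xs IH] [|t w].
- by exists (Fnot Ffalse) => z a; split=> // _ [].
- by exists Ffalse => z a; split.
- by exists Ffalse => z a; split.
have [A AD] := IH w.
pose h (v : 'I_m + 'I_n) : W * 'I_n + 'I_m :=
  match v with inl i => inr i | inr i => inl (x, i) end.
exists (Fand (fpow (fmap h phi) t) A) => z a /=; rewrite AD.
have -> : sat (fpow (fmap h phi) t) (sumval (fun v => z v.1 v.2) a) <->
    truth a (z x) = t.
  have -> : truth a (z x) = `[< sat (fmap h phi) (sumval (fun v => z v.1 v.2) a) >].
    by rewrite sat_fmap; congr asbool; congr sat; apply/funext => -[].
  case: t => /=; first by split=> [/asboolP|/asboolP].
  by split=> [/asboolPn/negbTE|/negbT/asboolPn].
by split=> [[-> ->]|[]].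
Qed.

(** * Indiscernible sequences *)

Section Indiscernible.
Context {d : Order.disp_t} {I : orderType d}.
Variables (b : I -> tup) (b_indisc : indiscernible b).

(** Indiscernibility speaks of increasing tuples; through [f] the variables may read the positions
    of such a tuple in any order and with repetitions. *)
Lemma indisc_definable (W : Type) (D : (W -> tup) -> Prop) (f : W -> nat)
    (x0 : I) (s t : seq I) :
  definable D -> sorted <%O s -> sorted <%O t -> size s = size t ->
  (forall w, f w < size s)%N ->
  D (fun w => b (nth x0 s (f w))) <-> D (fun w => b (nth x0 t (f w))).
Proof.
move=> [A AD] ss st est fs.
pose h (v : W * 'I_n) := (Ordinal (fs v.1), v.2).
have ord_inc (r : seq I) : sorted <%O r -> size s = size r ->
    forall i j : 'I_(size s), (i < j)%N -> (nth x0 r i < nth x0 r j)%O.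
  move=> sr er i j ij.
  by rewrite (lt_sorted_ltn_nth x0 sr) ?inE -?er.
have := b_indisc (ord_inc s ss erefl) (ord_inc t st est) (fmap h A).
by rewrite !sat_fmap -!AD.
Qed.

Lemma indisc_pattern (w : seq bool) (s t : seq I) :
  sorted <%O s -> sorted <%O t -> size s = size t ->
  pattern w (map b s) <-> pattern w (map b t).
Proof.
case: s => [|x0 s]; first by case: t.
move: (x0 :: s) => {}s ss st est.
have mapE (r : seq I) : size s = size r ->
    map b r = map (fun i : 'I_(size s) => b (nth x0 r i)) (enum 'I_(size s)).
  by move=> er; rewrite (map_comp b (fun i => nth x0 r (val i))) map_nth_enum.
rewrite (mapE s erefl) (mapE t est).
have := @indisc_definable _ _ (@nat_of_ord _) x0 s t
  (definable_pattern w (enum 'I_(size s))) ss st est (@ltn_ord _).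
by [].
Qed.

(** Since [x] and [y] lie on the same side of every parameter [q w], inserting either of them into
    the sorted list of parameters gives increasing lists [lo ++ x :: hi] and [lo ++ y :: hi] in
    which each parameter has the same position. *)
Lemma indisc_swap (W : finType) (D : (option W -> tup) -> Prop) (q : W -> I)
    (x y : I) : definable D ->
  (forall w, (q w < x)%O && (q w < y)%O || (x < q w)%O && (y < q w)%O) ->
  D (oapp (b \o q) (b x)) <-> D (oapp (b \o q) (b y)).
Proof.
move=> dD sep.
pose ps := sort <=%O (undup (codom q)).
have sps : sorted <%O ps by rewrite lt_sorted_uniq_le sort_uniq undup_uniq sort_le_sorted.
pose lo := [seq p <- ps | (p < x)%O]; pose hi := [seq p <- ps | (x < p)%O].
have mem_ps p : p \in ps -> exists w, p = q w.
  by rewrite mem_sort mem_undup => /codomP.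
have srt z : z \in [:: x; y] -> sorted <%O (lo ++ z :: hi).
  move=> zxy; rewrite lt_sorted_pairwise pairwise_cat /=.
  rewrite -!lt_sorted_pairwise !lt_sorted_filter // !andbT.
  have sepz p : p \in ps -> (p < x)%O && (p < z)%O || (x < p)%O && (z < p)%O.
    move=> /mem_ps[w ->]; have := sep w; move: zxy; rewrite !inE => /orP[]/eqP-> //.
    by case/orP=> /andP[-> ?] //; rewrite orbT.
  apply/andP; split; last first.
    apply/allP => p; rewrite mem_filter => /andP[xp /sepz].
    by case/orP=> /andP[// /lt_trans/(_ xp)]; rewrite ltxx.
  apply/allrelP => p p'; rewrite mem_filter inE => /andP[px /sepz pz].
  case/predU1P=> [->|].
    by case/orP: pz => /andP[// /lt_trans/(_ px)]; rewrite ltxx.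
  by rewrite mem_filter => /andP[xp' _]; apply: lt_trans px xp'.
pose f (o : option W) :=
  oapp (fun w => index (q w) (lo ++ x :: hi)) (size lo) o.
have qx w : (x == q w) = false.
  by apply/eqP => E; have := sep w; rewrite E ltxx /= ?andbF.
have qy w : (y == q w) = false.
  by apply/eqP => E; have := sep w; rewrite E ltxx /= ?andbF.
have qmem w : q w \in lo ++ hi.
  rewrite mem_cat !mem_filter mem_sort mem_undup codom_f !andbT.
  by case/orP: (sep w) => /andP[-> _]; rewrite ?orbT.
have qin w z : q w \in lo ++ z :: hi.
  by have := qmem w; rewrite !mem_cat inE => /orP[->|->//]; rewrite ?orbT.
have fE w : f (Some w) = index (q w) (lo ++ y :: hi).
  by rewrite /f /= !index_cat /= qx qy.
have := @indisc_definable _ D f x (lo ++ x :: hi) (lo ++ y :: hi) dD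
  (srt x (mem_head _ _)) (srt y (mem_last _ [:: y])).
have -> : (fun o => b (nth x (lo ++ x :: hi) (f o))) = oapp (b \o q) (b x).
  by apply/funext => -[w|] /=; rewrite ?nth_index // nth_cat ltnn subnn.
have -> : (fun o => b (nth x (lo ++ y :: hi) (f o))) = oapp (b \o q) (b y).
  apply/funext => -[w|]; first by rewrite fE /= nth_index.
  by rewrite /= nth_cat ltnn subnn.
apply; first by rewrite !size_cat.
case=> [w|] /=; first by rewrite index_mem.
by rewrite size_cat /= addnS ltnS leq_addr.
Qed.

End Indiscernible.

End Relations.

(** * Types over the range of a sequence *)

Section Types.
Variables (L : language) (C : structure L) (m n : nat).
Variable phi : formula L ('I_m + 'I_n).
Variables (X : Type) (b : X -> 'I_n -> C).

Lemma psat_truth (a : 'I_m -> C) (y : 'I_n -> C) (t : bool) :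
  psat (fpow (inst phi y) t) a <-> truth phi a y = t.
Proof. by rewrite psat_fpow psat_inst -/(truth phi a y); split=> ->. Qed.

(** If both extensions failed, the two finite culprits in [p] would have a common realization, which
    satisfies [A] or its negation. *)
Lemma consistent_split (p : set (formula L ('I_m + C))) (A : formula L ('I_m + C)) :
  consistent p -> exists t : bool, consistent (p `|` [set fpow A t]).
Proof.
move=> cp; apply: contrapT => /forallNP nc.
have bad t : exists F, [/\ finite_set F, F `<=` p &
    forall a, (forall B, F B -> psat B a) -> ~ psat (fpow A t) a].
  have /existsNP[F /not_implyP[finF /not_implyP[Fp nF]]] := nc t.
  exists (F `&` p); split; [exact: finite_setIl|exact: subIsetr|].
  move=> a aF aA; apply: nF; exists a => B FB.
  by have [pB|->//] := Fp _ FB; apply: aF.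
have [F1 [fin1 F1p F1a]] := bad true; have [F0 [fin0 F0p F0a]] := bad false.
have [a aF] : exists a, forall B, (F1 `|` F0) B -> psat B a.
  by apply: cp; [rewrite finite_setU|rewrite subUset].
have [Aa|nAa] := pselect (psat A a).
  by apply: (F1a a) => // B FB; apply: aF; left.
by apply: (F0a a) => // B FB; apply: aF; right.
Qed.

(** By maximality [p] contains each [phi(x; b i)] or its negation; consistency realizes finitely
    many of these literals by one tuple. *)
Lemma phi_type_pattern (p : set (formula L ('I_m + C))) (s : seq X) :
  phi_type phi (range b) p ->
  pattern phi [seq `[< p (inst phi (b i)) >] | i <- s] (map b s).
Proof.
move=> [psub pc pmax].
have tau i : p (fpow (inst phi (b i)) `[< p (inst phi (b i)) >]).
  have [t ct] := consistent_split (inst phi (b i)) pc.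
  have pt : p (fpow (inst phi (b i)) t).
    rewrite -[p](pmax _ _ ct); [by right| |by left].
    by move=> B [/psub//|->]; exists (b i) => //; exists t.
  case: asboolP => //= npi; case: t pt {ct} => //.
pose fs (r : seq X) : seq {classic (formula L ('I_m + C))} :=
  [seq fpow (inst phi (b i)) `[< p (inst phi (b i)) >] | i <- r].
have [||a aF] := pc [set` fs s].
- by apply: (finite_seq (T := {classic _})).
- elim: (s) => [//|i r IH] B /=; rewrite inE => /predU1P[->//|]; exact: IH.
exists a; elim: s aF => [//|i r IH] aF /=; rewrite IH; last first.
  by move=> B Br; apply: aF; rewrite /= inE Br orbT.
by congr cons; apply/psat_truth/aF; rewrite /= inE eqxx.
Qed.

(** The literals prescribed by [tau] form the type: they are finitely satisfiable by assumption, and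
    they are maximal because they already decide every instance. *)
Lemma pattern_phi_type (tau : X -> bool) :
  (forall s : seq X, pattern phi (map tau s) (map b s)) ->
  exists2 p, phi_type phi (range b) p &
    forall i, p (inst phi (b i)) <-> tau i.
Proof.
move=> real.
pose p := [set fpow (inst phi (b i)) (tau i) | i in [set: X]].
have pc : consistent p.
  move=> F /(@finite_seqP {classic _})[s ->] sp.
  suff [r Hr] : exists r : seq X, forall a, map (truth phi a) (map b r) = map tau r ->
      forall B, B \in s -> psat B a.
    by have [a /Hr Ha] := real r; exists a => B /Ha.
  elim: s sp => [|B s IH] sp; first by exists [::].
  have [B' B's|r Hr] := IH; first by apply: sp; rewrite /= inE B's orbT.
  have [i _ iB] : p B by apply: sp; rewrite /= inE eqxx.
  exists (i :: r) => a [ti /Hr tr] B'; rewrite inE => /predU1P[->|/tr//].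
  by rewrite -iB; apply/psat_truth.
(* Two members of a consistent set have a common realization, so a literal and its negation never
   occur together. *)
have two (q : set (formula L ('I_m + C))) A B : consistent q -> q A -> q B ->
    exists a, psat A a /\ psat B a.
  move=> cq qA qB; have [||a aAB] := cq [set A; B].
  - exact: finite_set2.
  - by move=> _ [->|->].
  - by exists a; split; apply: aAB; [left|right].
exists p; last first.
  move=> i; split=> [pi|ti]; last by exists i => //; rewrite ti.
  have pti : p (fpow (inst phi (b i)) (tau i)) by exists i.
  have [a [a1 /psat_truth <-]] := two _ _ _ pc pi pti.
  exact/(psat_truth a (b i) true).
split=> [_ [i _ <-]||q qsub qc pq]; [by exists (b i) => //; exists (tau i)|by []|].
apply/seteqP; split=> // A qA; have [_ [i _ <-] [t tA]] := qsub _ qA.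
rewrite tA in qA *; exists i => //; congr fpow.
have qti : q (fpow (inst phi (b i)) (tau i)) by apply: pq; exists i.
by have [a [/psat_truth <- /psat_truth <-]] := two _ _ _ qc qA qti.
Qed.

End Types.

(** * Coheir sequences *)

Section Coheir.
Variables (L : language) (kappa : Type) (C : structure L) (n : nat).
Hypothesis kappa_uncountable : small kappa [set: nat + (fsym L + rsym L)].
Hypothesis C_saturated : saturated kappa C.
Notation tup := ('I_n -> C).
Variable U : set_system nat.
Hypothesis U_ultra : UltraFilter U.
Hypothesis U_free : forall k, U [set N | (k <= N)%N].

Lemma ultra_iff (P Q : nat -> Prop) (k : nat) :
  (forall i, (k <= i)%N -> P i <-> Q i) ->
  U [set i | P i] <-> U [set i | Q i].
Proof.
by move=> PQ; split; apply: filterS2 (U_free k) => i /PQ PQi /PQi.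
Qed.

Definition below (j : nat) (v : nat + nat) : bool :=
  if v is inr j' then (j' < j)%N else true.

(** Each [c j] realizes the average type of [b] along [U] over all of [b] and the earlier [c j'].
    The variable [None] holds the tuple that is averaged. *)
Definition coheir (b c : nat -> tup) :=
  forall j (D : (option {v | below j v} -> tup) -> Prop), definable D ->
    D (oapp (sumval b c \o val) (c j)) <->
    U [set i | D (oapp (sumval b c \o val) (b i))].

(** The parameters [z] are their own constant limit, and [y] is added to them as the limit of the
    [b N]. *)
Lemma coheir_step (V : countType) (z : V -> tup) (b : nat -> tup) :
  exists y : tup, forall D : (option V -> tup) -> Prop, definable D ->
    D (oapp z y) <-> U [set i | D (oapp z (b i))].
Proof.
pose z1 (v : V * 'I_n) := z v.1 v.2.
have cz : countable (range z1).
  exact: card_le_trans (card_image_le _ _) (countableP _).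
have [y ylim] := is_limit_extends kappa_uncountable C_saturated U_ultra b cz
  (is_limit_const U_ultra z1).
exists y => D [A AD].
pose h (v : option V * 'I_n) : V * 'I_n + 'I_n :=
  if v.1 is Some x then inl (x, v.2) else inr v.2.
have M_gt (i : 'I_n) : (pickle i < (\max_(j < n) pickle j).+1)%N.
  by rewrite ltnS (leq_bigmax i).
have := is_limit_comp h (ylim _ id _ M_gt) A.
have E y' : sumval z1 (y' \o id) \o h = (fun v => oapp z y' v.1 v.2).
  by apply/funext => -[[x|] i].
rewrite E AD => ->; apply: (@ultra_iff _ _ 0) => i _.
by rewrite E AD.
Qed.

Lemma coheir_exists (b : nat -> tup) : exists c, coheir b c.
Proof.
pose base (s : seq tup) (v : nat + 'I_(size s)) : tup :=
  sumval b (fun j : 'I_(size s) => tnth (in_tuple s) j) v.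
(* A next term is fixed for every finite list of earlier terms; [st] then iterates this choice. *)
have /choice[nx nxP] := fun s => coheir_step (base s) b.
pose fix st k := if k is k'.+1 then rcons (st k') (nx (st k')) else [::].
pose c k := nx (st k).
have size_st k : size (st k) = k by elim: k => //= k IH; rewrite size_rcons IH.
have nth_st y0 k j : (j < k)%N -> nth y0 (st k) j = c j.
  elim: k => // k IH; rewrite ltnS leq_eqVlt => /predU1P[->|jk] /=.
    by rewrite nth_rcons size_st ltnn eqxx.
  by rewrite nth_rcons size_st jk IH.
exists c => j D dD.
have hP (v : {v | below j v}) : exists v' : nat + 'I_(size (st j)),
    sumval b c (val v) = base (st j) v'.
  case: v => -[i|j'] /= jj'; first by exists (inl i).
  have jj : (j' < size (st j))%N by rewrite size_st.
  by exists (inr (Ordinal jj)); rewrite /base /= (tnth_nth (b 0)) /= nth_st.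
have /choice[h hE] := hP.
have := nxP (st j) _ (definable_comp (omap h) dD).
have E y : oapp (base (st j)) y \o omap h = oapp (sumval b c \o val) y.
  by apply/funext => -[v|] //=; rewrite hE.
rewrite E => ->; apply: (@ultra_iff _ _ 0) => i _.
by rewrite E.
Qed.

Section CoheirTheory.
Variables (b c : nat -> tup) (bc : coheir b c).

(** The coheir property for a term inside a list: [c j] may be averaged wherever it stands, provided
    that all other entries are [below j]. *)
Lemma coheir_nth (k : nat) (D : ('I_k -> tup) -> Prop) (j : nat)
    (pre post : seq (nat + nat)) :
  definable D -> all (below j) (pre ++ post) ->
  D (fun i => nth (b 0) (map (sumval b c) pre ++ c j :: map (sumval b c) post) i)
  <-> U [set N | D (fun i =>
    nth (b 0) (map (sumval b c) pre ++ b N :: map (sumval b c) post) i)].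
Proof.
move=> dD all_below.
(* The entry [inl 0] is a placeholder at the position of [c j]. The default [inl 0] is [below j] and
   stands for [b 0], so positions beyond the end are harmless. *)
pose h (i : 'I_k) : option {v | below j v} :=
  if i == size pre :> nat then None
  else insub (nth (inl 0) (pre ++ inl 0 :: post) i).
have E y : oapp (sumval b c \o val) y \o h = (fun i =>
    nth (b 0) (map (sumval b c) pre ++ y :: map (sumval b c) post) i).
  apply/funext => i /=; rewrite /h; case: eqVneq => [->|ine] /=.
    by rewrite nth_cat size_map ltnn subnn.
  set v := nth _ _ _; have vj : below j v.
    have /all_nthP jall : all (below j) (pre ++ inl 0 :: post).
      by move: all_below; rewrite !all_cat.
    have [ilt|ige] := ltnP i (size (pre ++ inl 0 :: post)); first exact: jall.
    by rewrite /v nth_default.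
  rewrite insubT /= /v !nth_cat size_map; case: ltnP => [ilt|ige].
    by rewrite (nth_map (inl 0)).
  have : (0 < i - size pre)%N by rewrite subn_gt0 ltn_neqAle eq_sym ine.
  case: (i - size pre) => // q _ /=.
  have [qlt|qge] := ltnP q (size post); first by rewrite (nth_map (inl 0)).
  by rewrite !nth_default ?size_map.
have := bc (definable_comp h dD); rewrite E => ->.
by apply: (@ultra_iff _ _ 0) => i _; rewrite E.
Qed.

(** The iterated quantifier for [U]-almost all indices; the outermost one chooses the last entry of
    the list. *)
Fixpoint iterU (k : nat) (P : seq nat -> Prop) : Prop :=
  if k is k'.+1 then U [set i | iterU k' (fun s => P (rcons s i))] else P [::].

(** As [U] is free, each inner index can be taken above the outer ones; inner indices stand further
    left, so the list descends. *)
Lemma iterU_descending (k l : nat) (P : seq nat -> Prop) :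
  (forall s, size s = k -> pairwise gtn s -> all (leq l) s -> P s) -> iterU k P.
Proof.
elim: k l P => [|k IH] l P HP /=; first exact: HP.
apply: filterS (U_free l) => i li; apply: (IH i.+1) => s sk ds ls.
apply: HP; rewrite ?size_rcons ?sk // ?pairwise_rcons ?all_rcons ?ds ?li ?ls //=.
by apply: sub_all ls => x; apply: leq_trans; apply: leqW.
Qed.

(** The largest index in [s] comes last, and its term is a coheir over all the other entries. It is
    averaged first, and its replacement from [b] joins [t]. *)
Lemma coheir_iterU (k : nat) (D : ('I_k -> tup) -> Prop) (s t : seq nat) :
  definable D -> sorted ltn s ->
  D (fun i => nth (b 0) (map c s ++ map b t) i) <->
  iterU (size s) (fun r => D (fun i => nth (b 0) (map b r ++ map b t) i)).
Proof.
move=> dD; rewrite (sorted_pairwise ltn_trans).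
elim/last_ind: s t => [//|s j IH] t.
rewrite pairwise_rcons => /andP[sj ds].
rewrite map_rcons cat_rcons size_rcons /=.
have := @coheir_nth _ D j (map inr s) (map inl t) dD.
rewrite all_cat !all_map (eq_all (a2 := ltn^~ j)) // sj /= all_predT => /(_ isT).
rewrite -!map_comp /comp /= => ->.
apply: (@ultra_iff _ _ 0) => i _; have := IH (i :: t) ds; rewrite /= => ->.
suff -> : (fun r => D (fun i0 => nth (b 0) (map b (rcons r i) ++ map b t) i0)) =
  (fun r => D (fun i0 => nth (b 0) (map b r ++ b i :: map b t) i0)) by [].
by apply/funext => r; rewrite map_rcons cat_rcons.
Qed.

(** By [coheir_iterU], truth on an increasing tuple of [c] is an iterated [U]-statement about [b]
    that depends on the length of the tuple only. *)
Lemma coheir_indiscernible : indiscernible c.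
Proof.
move=> k s t sinc tinc A.
pose D (z : 'I_k -> tup) := sat A (fun v => z v.1 v.2).
have dD : definable D by exists A.
have lim (r : 'I_k -> nat) : (forall i j : 'I_k, (i < j)%N -> (r i < r j)%O) ->
    D (c \o r) <-> iterU k (fun r => D (fun i => nth (b 0) (map b r) i)).
  move=> /sorted_map_enum rinc.
  have := @coheir_iterU _ D _ [::] dD rinc.
  rewrite size_map size_enum_ord !cats0 -map_comp.
  have -> : (fun i : 'I_k => nth (b 0) (map (c \o r) (enum 'I_k)) i) = c \o r.
    by apply/funext => i; rewrite nth_map_enum.
  move=> ->; suff -> : (fun r0 => D (fun i => nth (b 0) (map b r0 ++ map b [::]) i)) =
    (fun r0 => D (fun i => nth (b 0) (map b r0) i)) by [].
  by apply/funext => r0; rewrite cats0.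
exact: iff_trans (lim s sinc) (iff_sym (lim t tinc)).
Qed.

(** Iterated limits reverse the order: what holds on descending tuples of [b] passes to increasing
    tuples of [c]. *)
Lemma coheir_pattern (m : nat) (phi : formula L ('I_m + 'I_n)) (w : seq bool)
    (s : seq nat) :
  (forall r, size r = size w -> pairwise gtn r -> pattern phi w (map b r)) ->
  sorted ltn s -> size s = size w -> pattern phi w (map c s).
Proof.
move=> bw ss sw.
pose D (z : 'I_(size w) -> tup) := pattern phi w (map z (enum 'I_(size w))).
have dD : definable D by exact: definable_pattern.
have := @coheir_iterU _ D s [::] dD ss; rewrite !cats0 /D map_nth_enum ?size_map // => ->.
rewrite sw; apply: (@iterU_descending _ 0) => r sr dr _.
by rewrite cats0 map_nth_enum ?size_map //; apply: bw.
Qed.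

End CoheirTheory.
End Coheir.

(** * The order type [omega + omega^*] *)

(** [inl] is the copy of [omega] and [inr] the reversed copy above it. The separate name carries
    this order. *)
Definition omega_cut := (nat + nat)%type.

HB.instance Definition _ := Countable.copy omega_cut (nat + nat)%type.

Section OmegaCut.

Definition cut_le (x y : omega_cut) : bool :=
  match x, y with
  | inl i, inl j => (i <= j)%N
  | inl _, inr _ => true
  | inr _, inl _ => false
  | inr i, inr j => (j <= i)%N
  end.

Definition cut_lt (x y : omega_cut) : bool := (y != x) && cut_le x y.

Lemma cut_le_anti : antisymmetric cut_le.
Proof. by move=> [i|i] [j|j] //=; rewrite -eqn_leq => /eqP->. Qed.

Lemma cut_le_trans : transitive cut_le.
Proof.
move=> [i|i] [j|j] [k|k] //=; first exact: leq_trans.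
by move=> ? /leq_trans; apply.
Qed.

Lemma cut_le_total : total cut_le.
Proof. by move=> [i|i] [j|j] //=; apply: leq_total. Qed.

HB.instance Definition _ := Order.isOrder.Build (Order.Disp tt tt) omega_cut
  (fun _ _ => erefl) (fun _ _ => erefl) (fun _ _ => erefl)
  cut_le_anti cut_le_trans cut_le_total.

End OmegaCut.

Lemma lt_inl_inl (i j : nat) : ((inl i : omega_cut) < inl j)%O = (i < j)%N.
Proof. by rewrite [LHS]/(cut_lt _ _) /cut_lt /= ltn_neqAle eq_sym. Qed.

Lemma lt_inl_inr (i j : nat) : ((inl i : omega_cut) < inr j)%O.
Proof. by []. Qed.

Lemma lt_inr_inl (i j : nat) : ((inr i : omega_cut) < inl j)%O = false.
Proof. by []. Qed.

Lemma lt_inr_inr (i j : nat) : ((inr i : omega_cut) < inr j)%O = (j < i)%N.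
Proof. by rewrite [LHS]/(cut_lt _ _) /cut_lt /= ltn_neqAle. Qed.

Definition cut_ltE := (lt_inl_inl, lt_inl_inr, lt_inr_inl, lt_inr_inr).

Lemma cut_sorted_split (r : seq omega_cut) : sorted <%O r ->
  exists s t, [/\ r = map inl s ++ map inr t, sorted ltn s & pairwise gtn t].
Proof.
rewrite lt_sorted_pairwise; elim: r => [|x r IH] /=; first by exists [::], [::].
case/andP=> xr /IH[s [t [rE ss st]]]; case: x xr => i xr.
  exists (i :: s), t; split=> //; first by rewrite rE.
  move: xr ss; rewrite !(sorted_pairwise ltn_trans) rE /= all_cat all_map.
  by move=> /andP[xr _] ->; rewrite andbT; apply: sub_all xr => j /=; rewrite cut_ltE.
case: s ss rE => [|j s] _ rE; last by move: xr; rewrite rE.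
exists [::], (i :: t); split=> //; first by rewrite rE.
rewrite /= st andbT; move: xr; rewrite rE /= all_map.
by apply: sub_all => j /=; rewrite cut_ltE.
Qed.

Section Cut.
Variables (L : language) (C : structure L) (n : nat).
Notation tup := ('I_n -> C).
Variable U : set_system nat.
Hypothesis U_ultra : UltraFilter U.
Hypothesis U_free : forall k, U [set N | (k <= N)%N].
Variables c d : nat -> tup.
Hypothesis c_indisc : indiscernible c.
Hypothesis cd : coheir U c d.

(** The head of [t] has the largest index among the terms of [d], so it is a coheir over the rest of
    the tuple. It can be replaced by some [c N] with [N] beyond [s], until only terms of [c] are
    left. *)
Lemma coheir_cut (k : nat) (D : ('I_k -> tup) -> Prop) (s t : seq nat) :
  definable D -> sorted ltn s -> pairwise gtn t -> size s + size t = k ->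
  D (fun i => nth (c 0) (map c s ++ map d t) i) <->
  D (fun i => c i).
Proof.
move=> dD; elim: t s => [|j t IH] s ss /=.
  rewrite cats0 addn0 => _ sk.
  have -> : (fun i : 'I_k => nth (c 0) (map c s) i) = (fun i : 'I_k => c (nth 0 s i)).
    by apply/funext => i; rewrite (nth_map 0) // sk.
  have := @indisc_definable _ _ _ _ _ _ c_indisc _ D (@nat_of_ord k) 0 s (iota 0 k)
    dD ss (iota_ltn_sorted _ _).
  rewrite size_iota sk => /(_ erefl (@ltn_ord k)) ->.
  by have -> : (fun i : 'I_k => c (nth 0 (iota 0 k) i)) = (fun i : 'I_k => c i);
    [apply/funext => i; rewrite nth_iota|].
case/andP=> jt st sk.
have := @coheir_nth _ _ _ _ U_ultra U_free c d cd _ D j (map inl s) (map inr t) dD.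
rewrite all_cat !all_map all_predT (eq_all (a2 := gtn j)) // jt => /(_ isT).
rewrite -!map_comp /comp /= => ->.
rewrite -[X in _ <-> X](ultra_const U_ultra).
apply: (ultra_iff U_ultra U_free (k := (\max_(i <- s) i).+1)) => N sN.
rewrite -(IH (rcons s N)) ?map_rcons ?cat_rcons // ?size_rcons ?addSnnS //.
rewrite (sorted_pairwise ltn_trans) pairwise_rcons -(sorted_pairwise ltn_trans) ss andbT.
by apply/allP => i si; apply: leq_ltn_trans sN; apply: leq_bigmax_seq.
Qed.

Lemma cut_indiscernible : indiscernible (sumval c d : omega_cut -> tup).
Proof.
move=> k s t sinc tinc A.
pose D (z : 'I_k -> tup) := sat A (fun v => z v.1 v.2).
have dD : definable D by exists A.
have lim (r : 'I_k -> omega_cut) :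
    (forall i j : 'I_k, (i < j)%N -> (r i < r j)%O) ->
    D ((sumval c d) \o r) <-> D (fun i => c i).
  move=> /sorted_map_enum rinc; have [s' [t' [rE ss st]]] := cut_sorted_split rinc.
  rewrite -(coheir_cut dD ss st); last first.
    by have := congr1 size rE; rewrite size_map size_enum_ord size_cat !size_map.
  have -> : map c s' ++ map d t' = map (sumval c d \o r) (enum 'I_k).
    by rewrite [RHS]map_comp rE map_cat -!map_comp.
  suff -> : (fun i : 'I_k => nth (c 0) (map (sumval c d \o r) (enum 'I_k)) i) =
    sumval c d \o r by [].
  by apply/funext => i; rewrite nth_map_enum.
exact: iff_trans (lim s sinc) (iff_sym (lim t tinc)).
Qed.

End Cut.

(** * The order property and the independence property *)

Section Converse.
Variables (L : language) (kappa : Type) (C : structure L) (m n : nat).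
Variable phi : formula L ('I_m + 'I_n).
Hypothesis kappa_uncountable : small kappa [set: nat + (fsym L + rsym L)].
Hypothesis C_saturated : saturated kappa C.
Notation tup := ('I_n -> C).

Lemma free_ultrafilter : exists U : set_system nat,
  UltraFilter U /\ forall k, U [set N | (k <= N)%N].
Proof.
have [U [U_ultra U_oo]] := ultraFilterLemma eventually_filter.
by exists U; split=> // k; apply: U_oo; exists k.
Qed.

Lemma definable_inst (W : Type) (psi : formula L ('I_n + W * 'I_n)) :
  definable (fun z : option W -> tup =>
    sat psi (sumval (z None) (fun w => z (Some w.1) w.2))).
Proof.
pose h (v : 'I_n + W * 'I_n) : option W * 'I_n :=
  match v with inl i => (None, i) | inr w => (Some w.1, w.2) end.
exists (fmap h psi) => z; rewrite sat_fmap.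
suff -> : (fun v => z v.1 v.2) \o h =
  sumval (z None) (fun w => z (Some w.1) w.2) by [].
by apply/funext => -[].
Qed.

Lemma pattern_phi_type_sorted (d : Order.disp_t) (I : orderType d)
    (b : I -> tup) (tau : I -> bool) :
  (forall s, sorted <%O s -> pattern phi (map tau s) (map b s)) ->
  exists2 p, phi_type phi (range b) p &
    forall i, p (inst phi (b i)) <-> tau i.
Proof.
move=> real; apply: pattern_phi_type => s.
pose r := sort <=%O (undup s).
have /real[a] : sorted <%O r.
  by rewrite lt_sorted_uniq_le sort_uniq undup_uniq sort_le_sorted.
rewrite -map_comp => /eq_in_map ar; exists a; rewrite -map_comp.
by apply/eq_in_map => i si; apply: ar; rewrite mem_sort mem_undup.
Qed.

(** By [indisc_swap], no formula over the [b (i k)] tells apart two terms that lie on the same side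
    of each of them. *)
Lemma definition_separates (d : Order.disp_t) (I : orderType d)
    (b : I -> tup) (tau : I -> bool) (p : set (formula L ('I_m + C)))
    (K : nat) (psi : formula L ('I_n + 'I_K * 'I_n)) (i : 'I_K -> I) (x y : I) :
  indiscernible b ->
  (forall k, (i k < x)%O && (i k < y)%O || (x < i k)%O && (y < i k)%O) ->
  (forall j, p (inst phi (b j)) <-> tau j) ->
  defines phi (inst psi (fun w => b (i w.1) w.2)) (range b) p ->
  tau x = tau y.
Proof.
move=> b_indisc sep ptau def.
have E z : psat (inst psi (fun w => b (i w.1) w.2)) (b z) <-> tau z.
  by rewrite -ptau; apply: def; exists z.
have := indisc_swap b_indisc (definable_inst psi) sep.
by move: (E x) (E y); rewrite !psat_inst /= => -> -> xy; apply/idP/idP => /xy.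
Qed.

(** With [r] descending, the index just above that of entry [p] cuts [r] after its first [p]
    entries. Shifting [b] by one makes room for the witness [a 0], which gives the all-true pattern
    when [q = 0]. *)
Lemma order_pattern (a : nat -> 'I_m -> C) (b : nat -> tup) (p q : nat)
    (r : seq nat) :
  (forall i j, sat phi (sumval (a i) (b j)) <-> (i < j)%N) ->
  size r = p + q -> pairwise gtn r ->
  pattern phi (nseq p true ++ nseq q false) (map (b \o S) r).
Proof.
move=> ab sr dr.
exists (a (if q is 0 then 0 else (nth 0 r p).+1)).
apply: (@eq_from_nth _ false); rewrite !size_map ?size_cat ?size_nseq // sr => j jr.
rewrite (nth_map (b 0)) ?size_map ?sr // (nth_map 0) ?sr //.
rewrite nth_cat !nth_nseq size_nseq /truth /=.
have -> : `[< sat phi (sumval (a (match q with 0 => 0 | _.+1 => (nth 0 r p).+1 end))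
    (b (nth 0 r j).+1)) >] =
  (match q with 0 => 0 | _.+1 => (nth 0 r p).+1 end < (nth 0 r j).+1)%N.
  by apply/asboolP/idP => /ab.
have dec i k : (i < k)%N -> (k < size r)%N -> (nth 0 r k < nth 0 r i)%N.
  by move=> ik kr; apply: (pairwiseP 0 dr) => //; apply: ltn_trans ik kr.
case: q sr jr => [|q] sr jr; first by rewrite addn0 in jr; rewrite jr.
rewrite ltnS; case: (ltnP j p) => [jp|pj].
  by rewrite dec // sr addnS ltnS leq_addr.
rewrite if_same; apply/negbTE; rewrite -leqNgt; move: pj; rewrite leq_eqVlt.
by case/predU1P=> [->//|pj]; rewrite ltnW // dec // sr.
Qed.

Lemma pattern_injective (d : Order.disp_t) (I : orderType d) (b : I -> tup) :
  (forall x y, (x < y)%O -> pattern phi [:: true; false] [:: b x; b y]) ->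
  injective b.
Proof.
move=> real x y bxy; apply/eqP; case: ltgtP => // /real[a];
  by rewrite /= bxy => -[->].
Qed.

Lemma stable_of_definitions :
  (exists (K : nat) (psi : formula L ('I_n + 'I_K * 'I_n)),
    forall (d : Order.disp_t) (I : orderType d) (b : I -> 'I_n -> C),
      small kappa (range b) -> injective b -> indiscernible b ->
      (exists i j : I, i <> j) ->
      forall p : set (formula L ('I_m + C)), phi_type phi (range b) p ->
        exists i : 'I_K -> I,
          defines phi (inst psi (fun w => b (i w.1) w.2)) (range b) p) ->
  stable C phi.
Proof.
move=> [K [psi def]] [a [b ab]].
have [U [U_ultra U_free]] := free_ultrafilter.
have [c bc] := coheir_exists kappa_uncountable C_saturated U_ultra U_free (b \o S).
have [d cd] := coheir_exists kappa_uncountable C_saturated U_ultra U_free c.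
have c_indisc := coheir_indiscernible U_ultra U_free bc.
have e_indisc := cut_indiscernible U_ultra U_free c_indisc cd.
set e : omega_cut -> tup := sumval c d in e_indisc.
have e_pattern p q (s : seq omega_cut) : sorted <%O s -> size s = p + q ->
    pattern phi (nseq p true ++ nseq q false) (map e s).
  (* By indiscernibility it suffices to treat the first [p + q] terms, where [e] is [c]. *)
  move=> ss sz; pose s' : seq omega_cut := map inl (iota 0 (p + q)).
  have ss' : sorted <%O s'.
    rewrite sorted_map; apply: sub_sorted (iota_ltn_sorted 0 (p + q)) => i j ij.
    by rewrite /= cut_ltE.
  have e_size : size s = size s' by rewrite size_map size_iota.
  apply/(indisc_pattern phi e_indisc _ ss ss' e_size); rewrite -map_comp.
  apply: (coheir_pattern U_ultra U_free bc).
  - move=> r; rewrite size_cat !size_nseq => rz dr.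
    exact: (order_pattern ab).
  - exact: iota_ltn_sorted.
  - by rewrite size_iota size_cat !size_nseq.
(* The cut in the middle: true on the lower half, false on the upper half. *)
pose tau (x : omega_cut) := if x is inl _ then true else false.
have [s ss|p p_type p_tau] := @pattern_phi_type_sorted _ omega_cut e tau.
  have [s' [t' [sE _ _]]] := cut_sorted_split ss.
  have const (r : seq nat) t : [seq t | _ <- r] = nseq (size r) t.
    by elim: r => //= _ r ->.
  have -> : map tau s = nseq (size s') true ++ nseq (size t') false.
    by rewrite sE map_cat -!map_comp /comp /= !const.
  by apply: e_pattern; rewrite // sE size_cat !size_map.
have e_inj : injective e.
  apply: pattern_injective => x y xy.
  by apply: (e_pattern 1 1 [:: x; y]) => //=; rewrite xy.
have [||i i_def] := def _ omega_cut e _ e_inj e_indisc _ p p_type.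
- apply: small_countable kappa_uncountable _ _ _.
  exact: card_le_trans (card_image_le _ _) (countableP _).
- by exists (inl 0), (inr 0).
(* Beyond the indices of all parameters, [inl M] and [inr M] are on the same side of each parameter
   but on different sides of the cut. *)
pose M := (\max_k (match i k with inl j => j | inr j => j end)).+1.
suff sep k : (i k < (inl M : omega_cut))%O && (i k < (inr M : omega_cut))%O ||
    ((inl M : omega_cut) < i k)%O && ((inr M : omega_cut) < i k)%O.
  by have := definition_separates e_indisc sep p_tau i_def.
have : (match i k with inl j => j | inr j => j end < M)%N.
  by rewrite ltnS (leq_bigmax k).
by case: (i k) => j jM; rewrite !cut_ltE jM ?orbT.
Qed.

(** * Shattered sequences and the independence property *)

Definition shatters (b : nat -> tup) :=
  forall (tau : nat -> bool) (M : nat), exists a,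
    forall j, (j < M)%N -> truth phi a (b j) = tau j.

Lemma shatters_pattern (b : nat -> tup) (w : seq bool) (r : seq nat) :
  shatters b -> uniq r -> size r = size w -> pattern phi w (map b r).
Proof.
move=> sh ur sr.
have [a Ha] := sh (fun j => nth false w (index j r)) (\max_(j <- r) j).+1.
exists a; apply: (@eq_from_nth _ false); rewrite !size_map // => j jr.
rewrite (nth_map (b 0)) ?size_map // (nth_map 0) // Ha ?index_uniq //.
by rewrite ltnS (leq_bigmax_seq _ (mem_nth 0 jr)).
Qed.

Definition shattered (N : nat) (f : 'I_N -> tup) :=
  forall tau : 'I_N -> bool, exists a, forall i, truth phi a (f i) = tau i.

Lemma card_le_of_not (T : Type) (B : set T) (N : nat) :
  ~ (B #<= `I_N) -> `I_N #<= B.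
Proof.
move=> BN; have [[k Bk]|/infiniteP natB] := pselect (finite_set B).
  have [BK kB] : B #<= `I_k /\ `I_k #<= B by apply/card_eqPle.
  apply: card_le_trans _ kB; rewrite card_le_II; apply/ltnW; rewrite ltnNge.
  by apply/negP => kN; apply: BN; apply: card_le_trans BK _; rewrite card_le_II.
exact: card_le_trans (subset_card_le (@subsetT _ _)) natB.
Qed.

Lemma not_dependent_shattered (N : nat) :
  ~ dependent C phi -> exists f : 'I_N -> tup, shattered f.
Proof.
move=> /forallNP/(_ N)/existsNP[B /not_implyP[B_ind /card_le_of_not/card_leP[g]]].
pose x (i : 'I_N) : `I_N := SigSub (mem_set (ltn_ord i : `I_N i)).
pose f i : tup := val (g (x i)).
have f_inj : injective f.
  move=> i j /val_inj gij; apply/val_inj.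
  by have /(congr1 val) := 'inj_g (in_setT (x i)) (in_setT (x j)) gij.
exists f => tau.
(* Signs must be given to all tuples, so [tau] is carried over along the injective [f] and is false
   elsewhere. *)
pose t y := `[< exists2 i, f i = y & tau i >].
have tf i : t (f i) = tau i.
  by apply/asboolP/idP => [[j /f_inj ->]|]; last exists i.
pose fs : seq {classic (formula L ('I_m + C))} :=
  [seq fpow (inst phi (f i)) (t (f i)) | i <- enum 'I_N].
have [||a Ha] := B_ind t [set` fs].
- by apply: (finite_seq (T := {classic _})).
- by move=> _ /= /mapP[i _ ->]; exists (f i) => //; apply: set_valP.
exists a => i; rewrite -tf; apply/psat_truth/Ha/mapP.
by exists i; rewrite ?mem_enum.
Qed.

(** A shattered family is injective, since some [a] separates any two of its members, and its range
    is independent; a bound on independent sets bounds its size. *)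
Lemma shattered_dependent :
  dependent C phi -> exists N, forall f : 'I_N -> tup, ~ shattered f.
Proof.
move=> [N dep]; exists N.+1 => f sh.
have f_inj : injective f.
  move=> i j fij; have [a Ha] := sh (pred1 i).
  by apply/esym/eqP; have := Ha j; rewrite -fij Ha /= eqxx => /esym.
have /dep BN : phi_independent phi (range f).
  move=> t F /(@finite_seqP {classic _})[s ->] sp.
  have [a Ha] := sh (t \o f); exists a => A /sp[_ [i _ <-] <-].
  exact/psat_truth/Ha.
have [_ fN] : range f #<= [set: 'I_N.+1] /\ [set: 'I_N.+1] #<= range f.
  by apply/card_eqPle/inj_card_eq => i j _ _ /f_inj.
have [N1 _] : `I_N.+1 #<= [set: 'I_N.+1] /\ [set: 'I_N.+1] #<= `I_N.+1.
  exact/card_eqPle/card_II.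
by have := card_le_trans N1 (card_le_trans fN BN); rewrite card_le_II ltnn.
Qed.

(** Compactness by a limit: the [j]-th term is a limit of the [j]-th terms of shattered families of
    growing size, and each pattern on the first [M] terms holds as soon as [M <= N]. *)
Lemma shattered_shatters :
  (forall N, exists f : 'I_N -> tup, shattered f) -> exists b, shatters b.
Proof.
move=> ex_f; pose f N := projT1 (cid (ex_f N)).
have f_sh N : shattered (f N) := projT2 (cid (ex_f N)).
have [U [U_ultra U_free]] := free_ultrafilter.
have [z0] := carrier_inhabited C.
pose x N (v : nat * 'I_n) := oapp (fun j => f N j v.2) z0 (insub v.1).
have cv : countable (range (of_void C)).
  exact: card_le_trans (card_image_le _ _) (countableP _).
have [c c_lim] := is_limit_extends kappa_uncountable C_saturated U_ultra x cv
  (is_limit_const U_ultra _).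
exists (fun j i => c (j, i)) => tau M.
pose w := mkseq tau M.
have [A AD] := definable_pattern C phi w (enum 'I_M).
pose g (v : 'I_M * 'I_n) : nat * 'I_n := (val v.1, v.2).
have gM v : (pickle (g v) < (\max_u pickle (g u)).+1)%N.
  by rewrite ltnS (leq_bigmax v).
have lim := is_limit_comp inr (c_lim _ g _ gM) A.
have [a Ha] : pattern phi w [seq (fun i => c (val j, i)) | j <- enum 'I_M].
  apply/AD/lim; apply: filterS (U_free M) => N MN.
  apply/(AD (fun j i => x N (val j, i))).
  have [a Ha] := f_sh N (tau \o val); exists a.
  rewrite /w /mkseq -val_enum_ord -!map_comp; apply/eq_map => j /=.
  rewrite -[tau j](Ha (widen_ord MN j)); congr truth; apply/funext => i.
  by rewrite /x /= insubT ?(leq_trans _ MN) // => jN; congr f; apply/val_inj.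
exists a => j jM; have := congr1 (fun s => nth false s j) Ha.
rewrite -map_comp nth_mkseq // => <-.
by rewrite (nth_map_enum false _ (Ordinal jM)).
Qed.

Lemma dependent_of_definitions :
  (exists (K : nat) (psi : formula L ('I_n + 'I_K * 'I_n)),
    forall (l : nat) (b : 'I_l -> 'I_n -> C),
      injective b -> indiscernible b -> (2 <= l)%N ->
      forall p : set (formula L ('I_m + C)), phi_type phi (range b) p ->
        exists i : 'I_K -> 'I_l,
          defines phi (inst psi (fun w => b (i w.1) w.2)) (range b) p) ->
  dependent C phi.
Proof.
move=> [K [psi def]]; apply: contrapT => ndep.
have [b b_sh] := shattered_shatters (not_dependent_shattered^~ ndep).
have [U [U_ultra U_free]] := free_ultrafilter.
have [c bc] := coheir_exists kappa_uncountable C_saturated U_ultra U_free b.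
have c_indisc := coheir_indiscernible U_ultra U_free bc.
have c_pattern w s : sorted ltn s -> size s = size w -> pattern phi w (map c s).
  apply: (coheir_pattern U_ultra U_free bc) => r rw dr.
  apply: shatters_pattern => //; rewrite uniq_pairwise.
  by apply: sub_pairwise dr => x y /= yx; rewrite neq_ltn yx orbT.
(* There are [K + 1] pairs of neighbours [2j], [2j + 1] with opposite values, so [K] parameters miss
   some pair. *)
pose l := (K.+1).*2; pose e (i : 'I_l) := c i.
have e_indisc : indiscernible e.
  by move=> k s t sinc tinc; apply: (c_indisc k (val \o s) (val \o t)).
pose tau (i : 'I_l) := odd i.
have [s ss|p p_type p_tau] := @pattern_phi_type_sorted _ _ e tau.
  have -> : map e s = map c (map val s) by rewrite -map_comp.
  by apply: c_pattern; rewrite ?size_map // sorted_map.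
have e_inj : injective e.
  apply: pattern_injective => x y xy.
  by apply: (c_pattern _ [:: val x; val y]) => //=; rewrite andbT.
have [//|i i_def] := def _ e e_inj e_indisc _ p p_type.
have half_lt (x : 'I_l) : (x./2 < K.+1)%N by rewrite ltn_half_double.
pose h k : 'I_K.+1 := Ordinal (half_lt (i k)).
have [j jh] : exists j, j \notin codom h.
  apply: contrapT => /forallNP allh.
  have : (#|'I_K.+1| <= #|codom h|)%N.
    apply/subset_leq_card/fintype.subsetP => j _.
    by apply: contrapT => /negP; apply: allh.
  by rewrite card_ord leqNgt ltnS (leq_trans (leq_image_card _ _)) // card_ord.
have j0 : (j.*2 < l)%N by rewrite ltn_double.
have j1 : (j.*2.+1 < l)%N by rewrite ltn_Sdouble.
have sep k : (i k < Ordinal j0)%O && (i k < Ordinal j1)%O ||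
    (Ordinal j0 < i k)%O && (Ordinal j1 < i k)%O.
  have : (i k)./2 != j.
    apply: contraNneq jh => kj; apply/codomP; exists k; exact/val_inj.
  rewrite !ltEord /= neq_ltn ltn_half_double geq_half_double doubleS.
  case/orP=> ij; apply/orP; first by left; rewrite ij ltnS ltnW.
  by right; rewrite ij ltnW.
by have := definition_separates e_indisc sep p_tau i_def; rewrite /tau /= odd_double.
Qed.

End Converse.

(** * Uniform definability *)

Section UniformDefinability.
Variables (L : language) (C : structure L) (n : nat).
Notation tup := ('I_n -> C).

Definition family := set tup -> set tup -> Prop.

(* One formula defines, with parameters from [B], the trace on [B] of every [X]
   with [P B X], as soon as [B] has two elements; two distinct parameters are
   what lets a single formula code a case distinction. *)
Definition unif_def (P : family) :=
  exists (W : finType) (D : (option W -> tup) -> Prop), definable D /\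
    forall B X, (exists y y', [/\ B y, B y' & y <> y']) -> P B X ->
      exists z : W -> tup, (forall w, B (z w)) /\
        forall y, B y -> (D (oapp z y) <-> X y).

Lemma unif_def_sub (P Q : family) :
  (forall B X, Q B X -> P B X) -> unif_def P -> unif_def Q.
Proof.
move=> QP [W [D [dD PD]]]; exists W, D; split=> // B X B2 /QP; exact: PD.
Qed.

Lemma unif_def_not (P : family) :
  unif_def P -> unif_def (fun B X => P B (~` X)).
Proof.
move=> [W [D [dD PD]]]; exists W, (fun z => ~ D z); split; first exact: definable_not.
move=> B X B2 /(PD _ _ B2)[z [Bz zD]]; exists z; split=> // y /zD ->.
by split=> [/contrapT|Xy nXy] //; apply: nXy.
Qed.

Section Combine.
Variables W1 W2 : finType.

Lemma oapp_sumval_inl (z1 : W1 -> tup) (z2 : W2 -> tup) (y : tup) :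
  oapp (sumval z1 z2) y \o omap inl = oapp z1 y.
Proof. by apply/funext => -[]. Qed.

Lemma oapp_sumval_inr (z1 : W1 -> tup) (z2 : W2 -> tup) (y : tup) :
  oapp (sumval z1 z2) y \o omap inr = oapp z2 y.
Proof. by apply/funext => -[]. Qed.

End Combine.

(** The two sets of parameters are placed side by side, as [W1 + W2]. A general connective [F]
    covers union, difference and symmetric difference at once. *)
Lemma unif_def_op (F : Prop -> Prop -> Prop) (P Q : family) :
  (forall W (D E : (W -> tup) -> Prop), definable D -> definable E ->
    definable (fun z => F (D z) (E z))) ->
  unif_def P -> unif_def Q ->
  unif_def (fun B X => exists X1 X2, [/\ P B X1, Q B X2 &
    forall y, B y -> (X y <-> F (X1 y) (X2 y))]).
Proof.
move=> dF [W1 [D1 [dD1 PD]]] [W2 [D2 [dD2 QD]]].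
exists (W1 + W2)%type, (fun z => F (D1 (z \o omap inl)) (D2 (z \o omap inr))).
split; first by apply: dF; apply: definable_comp.
move=> B X B2 [X1 [X2 [/(PD _ _ B2)[z1 [Bz1 E1]] /(QD _ _ B2)[z2 [Bz2 E2]] E]]].
exists (sumval z1 z2); split=> [[]//|y By].
rewrite oapp_sumval_inl oapp_sumval_inr E //.
by rewrite (propext (E1 y By)) (propext (E2 y By)).
Qed.

Lemma unif_def_xor (P Q : family) : unif_def P -> unif_def Q ->
  unif_def (fun B X => exists X1 X2, [/\ P B X1, Q B X2 &
    forall y, B y -> (X y <-> (X1 y /\ ~ X2 y) \/ (~ X1 y /\ X2 y))]).
Proof.
apply: (@unif_def_op (fun p q => (p /\ ~ q) \/ (~ p /\ q))) => W D E dD dE.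
by apply: definable_or; apply: definable_and => //; apply: definable_not.
Qed.

(** Two extra parameters choose the case: equal for [P], distinct for [Q]. The variables of the
    other case are filled with [y1]. *)
Lemma unif_def_or (P Q : family) :
  unif_def P -> unif_def Q -> unif_def (fun B X => P B X \/ Q B X).
Proof.
move=> [W1 [D1 [dD1 PD]]] [W2 [D2 [dD2 QD]]].
pose same (z : option (bool + (W1 + W2)) -> tup) :=
  z (Some (inl true)) = z (Some (inl false)).
exists (bool + (W1 + W2))%type, (fun z =>
  (same z /\ D1 ((z \o omap inr) \o omap inl)) \/
  (~ same z /\ D2 ((z \o omap inr) \o omap inr))).
split.
  apply: definable_or; apply: definable_and.
  - exact: definable_eq.
  - apply: (@definable_comp _ _ _ (option (W1 + W2)) _ (omap inr)
      (fun z => D1 (z \o omap inl))).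
    exact: definable_comp.
  - exact/definable_not/definable_eq.
  - apply: (@definable_comp _ _ _ (option (W1 + W2)) _ (omap inr)
      (fun z => D2 (z \o omap inr))).
    exact: definable_comp.
move=> B X B2; have [y1 [y2 [By1 By2 y12]]] := B2.
case=> [/(PD _ _ B2)[z [Bz E]]|/(QD _ _ B2)[z [Bz E]]].
  exists (sumval (fun=> y1) (sumval z (fun=> y1))); split=> [[t|[]]//|y By].
  rewrite oapp_sumval_inr oapp_sumval_inl E // /same /=.
  by split=> [[[]|[]]//|Xy]; left.
exists (sumval (fun t : bool => if t then y1 else y2) (sumval (fun=> y1) z)).
split=> [[[]|[]]//|y By].
rewrite !oapp_sumval_inr E // /same /=.
by split=> [[[]//|[]//]|Xy]; right.
Qed.

Lemma unif_def_set0 : unif_def (fun B X => forall y, B y -> ~ X y).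
Proof.
exists void, (fun=> False); split; first exact: definable_false.
move=> B X _ X0; exists (of_void tup); split=> [[]|y /X0 nX] //.
Qed.

Lemma unif_def_exists (T : finType) (P : T -> family) :
  (forall t, unif_def (P t)) -> unif_def (fun B X => exists t, P t B X).
Proof.
move=> dP; suff : unif_def (fun B X => exists2 t, t \in enum T & P t B X).
  by apply: unif_def_sub => B X [t Pt]; exists t; rewrite ?mem_enum.
elim: (enum T) => [|t s IH].
  by apply: unif_def_sub unif_def_set0 => B X [].
apply: unif_def_sub (unif_def_or (dP t) IH) => B X [t'].
by rewrite inE => /predU1P[->|t's Pt']; [left|right; exists t'].
Qed.

Lemma unif_def_param (W : finType) (D : (option W -> tup) -> Prop) :
  definable D -> unif_def (fun B X => exists z : W -> tup,
    (forall w, B (z w)) /\ forall y, B y -> (X y <-> D (oapp z y))).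
Proof.
move=> dD; exists W, D; split=> // B X _ [z [Bz E]].
by exists z; split=> // y /E ->.
Qed.

Definition small_trace (M : nat) : family := fun B X =>
  exists s : seq {classic tup}, [/\ (size s <= M)%N, forall y, y \in s -> B y &
    forall y, B y -> (X y <-> y \in s)].

(** The elements of the trace are listed as parameters and padded by repeating the first one; the
    empty trace has none to repeat and is treated apart. *)
Lemma unif_def_small (M : nat) : unif_def (small_trace M).
Proof.
pose D (z : option 'I_M -> tup) := exists i, z None = z (Some i).
have dD : definable D.
  suff : definable (fun z : option 'I_M -> tup =>
      exists2 i, i \in enum 'I_M & z None = z (Some i)).
    apply: definable_ext => z; split=> [[i _ zi]|[i zi]]; first by exists i.
    by exists i; rewrite ?mem_enum.
  elim: (enum 'I_M) => [|i s IH].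
    by apply: definable_ext (definable_false _ _ _) => z; split=> [|[]].
  apply: definable_ext (definable_or (definable_eq C n None (Some i)) IH) => z.
  split=> [[zi|[j js zj]]|[j]].
  - by exists i; rewrite ?mem_head.
  - by exists j; rewrite // inE js orbT.
  - by rewrite inE => /predU1P[->|js zj]; [left|right; exists j].
apply: unif_def_sub (unif_def_or unif_def_set0 (unif_def_param dD)).
move=> B X [[|y0 s] [sM sB E]]; first by left=> y By /(E _ By).
right; exists (fun i : 'I_M => nth y0 (y0 :: s) i); split=> [i|y By].
  have [ilt|ige] := ltnP i (size (y0 :: s)); first exact/sB/mem_nth.
  by rewrite nth_default //; apply/sB/mem_head.
rewrite E //; split=> [/(nthP y0)[i iM iy]|[i /= ->]].
  by exists (Ordinal (leq_trans iM sM)).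
have [ilt|ige] := ltnP i (size (y0 :: s)).
  exact: (@mem_nth {classic tup} y0 (y0 :: s)).
by rewrite nth_default //; apply: (@mem_head {classic tup}).
Qed.

Lemma unif_def_formula (P : family) : unif_def P ->
  exists (K : nat) (psi : formula L ('I_n + 'I_K * 'I_n)),
    forall (I : Type) (b : I -> tup) (X : set tup),
      (exists i j, b i <> b j) -> P (range b) X ->
      exists i : 'I_K -> I, forall y, range b y ->
        (psat (inst psi (fun w => b (i w.1) w.2)) y <-> X y).
Proof.
move=> [W [D [[A AD] PD]]].
pose h (v : option W * 'I_n) : 'I_n + 'I_#|W| * 'I_n :=
  if v.1 is Some w then inr (enum_rank w, v.2) else inl v.2.
exists #|W|, (fmap h A) => I b X [j [j' bjj']] PX.
have [|z [Bz E]] := PD _ _ _ PX; first by exists (b j), (b j'); split=> //; apply: imageT.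
have /choice[i ib] : forall w, exists i, b i = z w.
  by move=> w; have [i] := Bz w; exists i.
exists (i \o enum_val) => y By; rewrite psat_inst sat_fmap -E // -AD.
suff -> : sumval y (fun w => b ((i \o enum_val) w.1) w.2) \o h =
  (fun v => oapp z y v.1 v.2) by [].
by apply/funext => -[[w|] k] //=; rewrite enum_rankK ib.
Qed.

End UniformDefinability.

(** * Types over indiscernible sequences in stable formulas *)

Lemma many_or_few (I : eqType) (P : pred I) (M : nat) :
  (exists s, [/\ uniq s, size s = M & all P s]) \/
  (exists s, [/\ (size s <= M)%N, all P s & forall i, P i -> i \in s]).
Proof.
elim: M => [|M [[s [us sM Ps]]|[s [sM Ps sP]]]]; first by left; exists [::].
  have [[i /andP[Pi is_]]|/forallNP all_s] := pselect (exists i, P i && (i \notin s)).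
    by left; exists (i :: s); rewrite /= is_ us sM Pi Ps.
  right; exists s; split=> //; first by rewrite sM.
  by move=> i Pi; apply: contrapT => /negP is_; apply: (all_s i); rewrite Pi.
by right; exists s; split=> //; apply: leqW.
Qed.

Lemma map_all_const (I : Type) (f : I -> bool) (t : bool) (s : seq I) :
  all (fun i => f i == t) s -> map f s = nseq (size s) t.
Proof. by elim: s => //= i s IH /andP[/eqP -> /IH ->]. Qed.

(** The middle [x] of the [2N + 1] positive indices has [N] positive ones on each side. Of the
    [2N + 1] negative ones at least [N] lie on one side of [x]; they are paired with the positive
    block on the other side. *)
Lemma two_blocks (d : Order.disp_t) (I : orderType d) (tau : pred I) (N : nat)
    (s1 s2 : seq I) :
  uniq s1 -> size s1 = N.*2.+1 -> all tau s1 ->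
  uniq s2 -> size s2 = N.*2.+1 -> all (predC tau) s2 ->
  exists t (r : seq I), sorted <%O r /\ map tau r = nseq N t ++ nseq N (~~ t).
Proof.
have sort_sorted (s : seq I) : uniq s -> sorted <%O (sort <=%O s).
  by move=> us; rewrite lt_sorted_uniq_le sort_uniq us sort_le_sorted.
move=> /sort_sorted st1 z1 a1 /sort_sorted st2 z2 a2.
rewrite -(size_sort <=%O) in z1; rewrite -(size_sort <=%O) in z2.
rewrite -(all_sort _ <=%O) in a1; rewrite -(all_sort _ <=%O) in a2.
move: (sort _ s1) (sort _ s2) st1 z1 a1 st2 z2 a2 => {s1 s2} r1 r2 st1 z1 a1 st2 z2 a2.
have zlo : size (take N r1) = N.
  by rewrite size_takel // z1 leqW // -addnn leq_addr.
have [x [hi r1E]] : exists x hi, r1 = take N r1 ++ x :: hi.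
  have : (0 < size (drop N r1))%N by rewrite size_drop z1 subn_gt0 ltnS -addnn leq_addr.
  by rewrite -{2}(cat_take_drop N r1); case: (drop N r1) => // x hi _; exists x, hi.
have zhi : size hi = N.
  move: z1; rewrite r1E size_cat /= zlo -addnn addnS => -[/eqP].
  by rewrite eqn_add2l => /eqP.
set lo := take N r1 in r1E zlo.
have tau_r1 y : y \in r1 -> tau y by move/(allP a1).
have tau_r2 y : y \in r2 -> tau y = false by move/(allP a2)/negbTE.
have tx : tau x by apply: tau_r1; rewrite r1E mem_cat mem_head orbT.
move: st1; rewrite lt_sorted_pairwise r1E pairwise_cat /= allrel_consr.
case/and3P=> /andP[lox lohi] plo /andP[xhi phi].
pose r2lo := [seq y <- r2 | (y < x)%O]; pose r2hi := [seq y <- r2 | (x < y)%O].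
have z2' : size r2lo + size r2hi = N.*2.+1.
  rewrite -z2 !size_filter -(count_predC (fun y => y < x)%O r2); congr (_ + _).
  apply: eq_in_count => y /tau_r2 ty /=; rewrite -leNgt le_eqVlt.
  by case: eqVneq => // E; rewrite -E tx in ty.
have s_lo : sorted <%O r2lo by apply: lt_sorted_filter.
have s_hi : sorted <%O r2hi by apply: lt_sorted_filter.
have [Nhi|hiN] := leqP N (size r2hi).
  exists true, (lo ++ take N r2hi); split.
    rewrite lt_sorted_pairwise pairwise_cat plo -lt_sorted_pairwise take_sorted // !andbT.
    apply/allrelP => y y' ylo /mem_take; rewrite mem_filter => /andP[xy' _].
    exact: lt_trans (allP lox _ ylo) xy'.
  rewrite map_cat (@map_all_const _ tau true) ?(@map_all_const _ tau false)
    ?zlo ?size_takel //.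
    apply/allP => y /mem_take; rewrite mem_filter => /andP[_ /tau_r2 ->]; exact: eqxx.
  by apply/allP => y ylo; rewrite tau_r1 // r1E mem_cat ylo.
have Nlo : (N <= size r2lo)%N.
  by move: z2' hiN; rewrite -addnn; lia.
exists false, (take N r2lo ++ hi); split.
  rewrite lt_sorted_pairwise pairwise_cat phi -lt_sorted_pairwise take_sorted // !andbT.
  apply/allrelP => y y' /mem_take; rewrite mem_filter => /andP[yx _] y'hi.
  exact: lt_trans yx (allP xhi _ y'hi).
rewrite map_cat (@map_all_const _ tau false) ?(@map_all_const _ tau true)
  ?zhi ?size_takel //.
  by apply/allP => y yhi; rewrite tau_r1 // r1E mem_cat inE yhi !orbT.
by apply/allP => y /mem_take; rewrite mem_filter => /andP[_ /tau_r2 ->].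
Qed.

Section Stable.
Variables (L : language) (kappa : Type) (C : structure L) (m n : nat).
Variable phi : formula L ('I_m + 'I_n).
Hypothesis kappa_uncountable : small kappa [set: nat + (fsym L + rsym L)].
Hypothesis C_saturated : saturated kappa C.
Notation tup := ('I_n -> C).

Definition order_upto (N : nat) (a : nat -> 'I_m -> C) (b : nat -> tup) :=
  forall i j, (i < N)%N -> (j < N)%N -> truth phi (a i) (b j) = (i < j)%N.

(** Compactness: for orders of every length [N], all coordinates of both sequences are taken to the
    limit together, which gives the order property. *)
Lemma stable_bound :
  stable C phi -> exists N, forall a b, ~ order_upto N a b.
Proof.
move=> st; apply: contrapT => /forallNP long; apply: st.
have /choice[ab abP] : forall N, exists ab : (nat -> 'I_m -> C) * (nat -> tup),
    order_upto N ab.1 ab.2.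
  move=> N; have /existsNP[a /existsNP[b /contrapT ab]] := long N.
  by exists (a, b).
have [U [U_ultra U_free]] := free_ultrafilter.
pose x N (v : nat * 'I_m + nat * 'I_n) :=
  match v with inl v => (ab N).1 v.1 v.2 | inr v => (ab N).2 v.1 v.2 end.
have cv : countable (range (of_void C)).
  exact: card_le_trans (card_image_le _ _) (countableP _).
have [c c_lim] := is_limit_extends kappa_uncountable C_saturated U_ultra x cv
  (is_limit_const U_ultra _).
exists (fun i k => c (inl (i, k))), (fun j k => c (inr (j, k))) => i j.
pose g (v : 'I_m + 'I_n) : nat * 'I_m + nat * 'I_n :=
  match v with inl k => inl (i, k) | inr k => inr (j, k) end.
have gM v : (pickle (g v) < (\max_u pickle (g u)).+1)%N.
  by rewrite ltnS (leq_bigmax v).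
have := is_limit_comp inr (c_lim _ g _ gM) phi.
have -> : sumval (of_void C) (c \o g) \o inr =
    sumval (fun k => c (inl (i, k))) (fun k => c (inr (j, k))).
  by apply/funext => -[].
move=> ->; rewrite -[X in _ <-> X](ultra_const U_ultra).
apply: (ultra_iff U_ultra U_free (k := (maxn i j).+1)) => N.
rewrite gtn_max => /andP[iN jN]; rewrite -(abP N i j iN jN).
have -> : sumval (of_void C) (x N \o g) \o inr = sumval ((ab N).1 i) ((ab N).2 j).
  by apply/funext => -[].
by split=> /asboolP.
Qed.

(** Windows of [N] consecutive terms see the change of truth value at every possible place; by
    indiscernibility all these cuts are realized on the first [N] terms, which orders them. *)
Lemma long_order (d : Order.disp_t) (I : orderType d) (b : I -> tup) (N : nat)
    (t : bool) (r : seq I) :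
  indiscernible b -> sorted <%O r -> (0 < N)%N ->
  pattern phi (nseq N t ++ nseq N (~~ t)) (map b r) ->
  exists a b, order_upto N a b.
Proof.
move=> b_indisc sr N0 pr.
have zr : size r = N + N.
  by have := pattern_size pr; rewrite size_cat !size_nseq size_map.
have [x0 _] : exists x0 : I, True by case: r zr {pr sr} => [/= zr|x r]; [lia|exists x].
pose y k := nth x0 r k.
have cut j : (j <= N)%N -> exists a, forall k, (k < N)%N ->
    truth phi a (b (y k)) = (if (k < j)%N then t else ~~ t).
  move=> jN.
  pose w := mkseq (fun k => if (k < j)%N then t else ~~ t) N.
  (* The window starting at [N - j] contains exactly [j] terms of the first block. *)
  have [a Ha] : pattern phi w (map b (take N r)).
    have s1 : sorted <%O (take N r) by apply: take_sorted.
    have s2 : sorted <%O (take N (drop (N - j) r)) by apply/take_sorted/drop_sorted.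
    have z1 : size (take N r) = N by rewrite size_takel // zr; lia.
    have z2 : size (take N (drop (N - j) r)) = N.
      by rewrite size_takel // size_drop zr; lia.
    apply/(indisc_pattern phi b_indisc w s1 s2 (etrans z1 (esym z2))).
    case: pr => a Ha; exists a; apply: (@eq_from_nth _ false).
      by rewrite !size_map z2 size_iota.
    rewrite !size_map z2 => k kN.
    rewrite (nth_map (b x0)) ?size_map ?z2 // (nth_map x0) ?z2 //.
    rewrite nth_take // nth_drop nth_mkseq //.
    have kr : (N - j + k < size r)%N by rewrite zr; lia.
    have := congr1 (fun s => nth false s (N - j + k)) Ha.
    rewrite (nth_map (b x0)) ?size_map // (nth_map x0) // => ->.
    rewrite nth_cat !nth_nseq size_nseq.
    have -> : (N - j + k < N)%N = (k < j)%N by lia.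
    by case: ltnP => // jk; rewrite (_ : (N - j + k - N < N)%N) //; lia.
  exists a => k kN; have := congr1 (fun s => nth false s k) Ha.
  rewrite (nth_map (b x0)) ?size_map ?size_takel ?zr //; try lia.
  by rewrite (nth_map x0) ?size_takel ?zr ?nth_take ?nth_mkseq //; lia.
(* For [t = true] the cuts are initial segments, so the terms are read backwards to obtain
   [i < j]. *)
case: t pr cut => pr cut.
  have /choice[a aP] : forall i, exists a, (i < N)%N -> forall k, (k < N)%N ->
      truth phi a (b (y k)) = (k < N.-1 - i)%N.
    move=> i; have [a aP] := cut (N.-1 - i) ltac:(lia).
    by exists a => iN k kN; rewrite aP //; case: ifP.
  exists a, (fun k => b (y (N.-1 - k))) => i j iN jN; rewrite aP //; lia.
have /choice[a aP] : forall i, exists a, (i < N)%N -> forall k, (k < N)%N ->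
    truth phi a (b (y k)) = (i < k)%N.
  move=> i; have [iN|Ni] := ltnP i N; last first.
    by have [a _] := cut 0 isT; exists a.
  have [a aP] := cut i.+1 iN.
  by exists a => _ k kN; rewrite aP //; rewrite ltnS leqNgt; case: (_ < _)%N.
by exists a, (fun k => b (y k)) => i j iN jN; rewrite aP.
Qed.

Lemma stable_small_trace : stable C phi -> exists M,
  forall (d : Order.disp_t) (I : orderType d) (b : I -> tup) p,
    injective b -> indiscernible b -> phi_type phi (range b) p ->
    small_trace M (range b) [set y | p (inst phi y)] \/
    small_trace M (range b) (~` [set y | p (inst phi y)]).
Proof.
move=> /stable_bound[N noN]; exists N.*2.+1 => d I b p b_inj b_indisc p_type.
have N0 : (0 < N)%N.
  rewrite lt0n; apply/eqP => N0; have [z0] := carrier_inhabited C.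
  by apply: (noN (fun _ _ => z0) (fun _ _ => z0)); rewrite N0.
pose tau (i : I) := `[< p (inst phi (b i)) >].
have few (P : pred I) (X : set tup) (s : seq I) :
    (forall i, P i <-> X (b i)) -> (size s <= N.*2.+1)%N -> all P s ->
    (forall i, P i -> i \in s) -> small_trace N.*2.+1 (range b) X.
  move=> PX sN Ps sP; exists (map b s : seq {classic tup}); split.
  - by rewrite size_map.
  - by move=> _ /mapP[i _ ->]; exists i.
  - move=> _ [i _ <-]; rewrite -PX; split=> [/sP is_|/mapP[j js /b_inj ->]].
      by apply/mapP; exists i.
    exact: (allP Ps).
have [[s1 [u1 z1 a1]]|[s [sM Ps sP]]] := many_or_few tau N.*2.+1; last first.
  by left; apply: (few tau) sM Ps sP => i; split=> /asboolP.
have [[s2 [u2 z2 a2]]|[s [sM Ps sP]]] := many_or_few (predC tau) N.*2.+1; last first.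
  by right; apply: (few (predC tau)) sM Ps sP => i; split=> /asboolPn.
have [t [r [sr rE]]] := two_blocks u1 z1 a1 u2 z2 a2.
have := phi_type_pattern r p_type; rewrite -/tau rE.
by move=> /(long_order b_indisc sr N0)[a [b' /noN]].
Qed.

Lemma definitions_of_stable : stable C phi ->
  exists (K : nat) (psi : formula L ('I_n + 'I_K * 'I_n)),
    forall (d : Order.disp_t) (I : orderType d) (b : I -> 'I_n -> C),
      small kappa (range b) -> injective b -> indiscernible b ->
      (exists i j : I, i <> j) ->
      forall p : set (formula L ('I_m + C)), phi_type phi (range b) p ->
        exists i : 'I_K -> I,
          defines phi (inst psi (fun w => b (i w.1) w.2)) (range b) p.
Proof.
move=> /stable_small_trace[M HM].
have dM := unif_def_small C n M.
have [K [psi psiP]] := unif_def_formula (unif_def_or dM (unif_def_not dM)).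
exists K, psi => d I b _ b_inj b_indisc [i [j ij]] p p_type.
apply: psiP; last exact: HM.
by exists i, j => /b_inj.
Qed.

End Stable.

(** * Types over finite indiscernible sequences in dependent formulas *)

Section AdjacentSwaps.
Variable S : seq bool -> Prop.
Hypothesis S_swap : forall u v t, S (u ++ t :: ~~ t :: v) -> S (u ++ ~~ t :: t :: v).

Lemma swap_iff (u v : seq bool) :
  S (u ++ false :: true :: v) <-> S (u ++ true :: false :: v).
Proof. by split; [apply: (S_swap (t := false))|apply: (S_swap (t := true))]. Qed.

Lemma swap_nseq (a : nat) (u v : seq bool) :
  S (u ++ false :: nseq a true ++ v) <-> S (u ++ nseq a true ++ false :: v).
Proof.
elim: a u => [//|a IH] u; rewrite /= swap_iff.
by rewrite -!(cat_rcons true u) IH.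
Qed.

(** Adjacent exchanges sort a word, so membership in [S] depends only on how often each value
    occurs. *)
Lemma swap_sort (u w : seq bool) :
  S (u ++ w) <-> S (u ++ nseq (count id w) true ++ nseq (count negb w) false).
Proof.
elim: w u => [//|x w IH] u; rewrite -cat_rcons IH cat_rcons; case: x => //=.
by rewrite ?add0n ?add1n swap_nseq.
Qed.

Lemma swap_count (w w' : seq bool) :
  count id w = count id w' -> count negb w = count negb w' -> S w -> S w'.
Proof.
move=> e e' Sw; apply/(iffRL (swap_sort [::] w')); rewrite -e -e'.
exact: (iffLR (swap_sort [::] w)).
Qed.

End AdjacentSwaps.

(** * Switches of a Boolean sequence *)

Section Switches.
Variables (tau : nat -> bool) (l : nat).

Definition switches := [seq k <- iota 1 l.-1 | tau k != tau k.-1].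

Lemma switches_sorted : sorted ltn switches.
Proof. exact: (sorted_filter ltn_trans) (iota_ltn_sorted _ _). Qed.

Lemma switches_lt : all (gtn l) switches.
Proof.
by apply/allP => k; rewrite mem_filter mem_iota /= => /andP[_]; lia.
Qed.

(** Each switch flips the value, so [tau] is recovered from [tau 0] by counting switches modulo
    2. *)
Lemma switches_parity (i : nat) : (i < l)%N ->
  tau i = tau 0 (+) odd (count (leq^~ i) switches).
Proof.
move=> il.
have -> : count (leq^~ i) switches = count (fun k => tau k != tau k.-1) (iota 1 i).
  rewrite /switches; rewrite (_ : l.-1 = i + (l.-1 - i)); last by lia.
  rewrite iotaD filter_cat count_cat !count_filter.
  rewrite [X in _ + X](_ : _ = 0) ?addn0; last first.
    apply/eqP; rewrite -leqn0 leqNgt -has_count; apply/hasPn => k.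
    by rewrite mem_iota /=; lia.
  apply: eq_in_count => k; rewrite mem_iota /= => ki.
  by rewrite (_ : (k <= i)%N) //; lia.
elim: i {il} => [|i IH]; first by rewrite addbF.
rewrite -addn1 iotaD count_cat /= addn0 oddD addbA -IH addn1 add1n /=.
by case: (tau i); case: (tau i.+1).
Qed.

Lemma count_le_nth (s : seq nat) (j : nat) :
  sorted ltn s -> (j < size s)%N -> count (leq^~ (nth 0 s j)) s = j.+1.
Proof.
elim: s j => [//|k s IH] j /= ks js.
have ss := path_sorted ks.
have ks' : all (ltn k) s by apply: order_path_min ks; apply: ltn_trans.
case: j js => [_|j js] /=.
  rewrite leqnn [X in _ + X](_ : _ = 0) //.
  apply/eqP; rewrite -leqn0 leqNgt -has_count; apply/hasPn => i /(allP ks') /=.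
  by lia.
rewrite IH //; have := allP ks' _ (mem_nth 0 js); rewrite /=; lia.
Qed.

Lemma switches_alternate (j : nat) : (j < size switches)%N ->
  tau (nth 0 switches j) = tau 0 (+) ~~ odd j.
Proof.
move=> js; rewrite switches_parity ?count_le_nth ?switches_sorted //.
exact: (allP switches_lt _ (mem_nth 0 js)).
Qed.

End Switches.

(** * Definable cuts of finite sequences *)

Section Dependent.
Variables (L : language) (C : structure L) (m n : nat).
Variable phi : formula L ('I_m + 'I_n).
Notation tup := ('I_n -> C).

Definition inj_below (l : nat) (b : nat -> tup) :=
  forall i j, (i < l)%N -> (j < l)%N -> b i = b j -> i = j.

Lemma small_trace_below (M l : nat) (b : nat -> tup) (X : set tup) (s : seq nat) :
  inj_below l b -> (size s <= M)%N -> all (gtn l) s ->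
  (forall i, (i < l)%N -> X (b i) <-> i \in s) ->
  small_trace M (b @` `I_l) X.
Proof.
move=> b_inj sM sl Xs; exists (map b s : seq {classic tup}); split.
- by rewrite size_map.
- by move=> _ /mapP[i /(allP sl) /= il ->]; exists i.
move=> _ [i il <-]; rewrite Xs //; split=> [is_|/mapP[j js bij]].
  by apply/mapP; exists i.
by rewrite (b_inj i j) //; apply: (allP sl).
Qed.

(* The two adjacent truth values [t, ~~ t] can be realized between [u] and [v]
   in this order but not in the other: this is what makes the order of the
   sequence definable from its first [size u] and last [size v] terms. *)
Definition orders (u v : seq bool) (t : bool) (l : nat) (b : nat -> tup) :=
  forall s, sorted ltn s -> all (gtn l) s -> size s = size u + (size v).+2 ->
    pattern phi (u ++ t :: ~~ t :: v) (map b s) /\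
    ~ pattern phi (u ++ ~~ t :: t :: v) (map b s).

Definition initial_trace (u v : seq bool) (t : bool) : family C n := fun B X =>
  exists l b k, [/\ inj_below l b, orders u v t l b, B = b @` `I_l &
    forall i, (i < l)%N -> X (b i) <-> (i < k)%N].

Lemma pattern_swap (u v : seq bool) (t t' : bool) (e f : seq tup) (y y' : tup) :
  size e = size u ->
  pattern phi (u ++ t :: t' :: v) (e ++ y :: y' :: f) ->
  pattern phi (u ++ t' :: t :: v) (e ++ y' :: y :: f).
Proof.
move=> eu [a]; rewrite map_cat /= => /eqP; rewrite eqseq_cat ?size_map //.
case/andP=> /eqP eE /eqP[yE y'E fE]; exists a.
by rewrite map_cat /= eE yE y'E fE.
Qed.

(** A cut near either end leaves few terms on one side. Otherwise the pattern in which [y] comes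
    just before the pivot [b k.-1], between the first [size u] and the last [size v] terms, compares
    [y] with the pivot. *)
Lemma unif_def_initial (u v : seq bool) (t : bool) :
  unif_def (initial_trace u v t).
Proof.
pose W := ('I_(size u) + (unit + 'I_(size v)))%type.
pose xs : seq (option W) := map (fun i => Some (inl i)) (enum 'I_(size u)) ++
  None :: Some (inr (inl tt)) ::
  map (fun i => Some (inr (inr i))) (enum 'I_(size v)).
have dR := definable_pattern C phi (u ++ t :: ~~ t :: v) xs.
have dsmall M := unif_def_small C n M.
have dand W' (D E : (W' -> tup) -> Prop) : definable D -> definable E ->
    definable (fun z => D z /\ ~ E z).
  by move=> dD dE; apply: definable_and => //; apply: definable_not.
have dmid := unif_def_op (F := or) (@definable_or L C n)
  (unif_def_op (F := fun p q => p /\ ~ q) dand (unif_def_param dR)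
    (dsmall (size v))) (dsmall (size u).+1).
apply: unif_def_sub (unif_def_or (dsmall (size u))
  (unif_def_or (unif_def_not (dsmall (size v))) dmid)).
move=> B X [l [b [k [b_inj b_ord -> Xk]]]].
have [ku|uk] := leqP k (size u).
  left; apply: (small_trace_below (s := iota 0 (minn k l)) b_inj).
  - by rewrite size_iota; lia.
  - by apply/allP => i; rewrite mem_iota /=; lia.
  - by move=> i il; rewrite Xk // mem_iota /=; lia.
right; have [lk|kl] := ltnP (l - size v) k.
  left; apply: (small_trace_below (s := iota k (l - k)) b_inj).
  - by rewrite size_iota; lia.
  - by apply/allP => i; rewrite mem_iota /=; lia.
  - by move=> i il; rewrite /setC /= Xk // mem_iota; lia.
right.
pose z (w : W) : tup := match w with
  | inl i => b i
  | inr (inl _) => b k.-1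
  | inr (inr i) => b (l - size v + i)
  end.
pose R (y : tup) := pattern phi (u ++ t :: ~~ t :: v)
  (map b (iota 0 (size u)) ++ y :: b k.-1 :: map b (iota (l - size v) (size v))).
have zR y : map (oapp z y) xs =
  map b (iota 0 (size u)) ++ y :: b k.-1 :: map b (iota (l - size v) (size v)).
  rewrite map_cat /= -!map_comp -[X in iota X (size v)]addn0 iotaDl.
  by rewrite -!val_enum_ord -!map_comp.
pose s i j := iota 0 (size u) ++ i :: j :: iota (l - size v) (size v).
have s_ord i j : (size u <= i)%N -> (i < j)%N -> (j < l - size v)%N ->
    pattern phi (u ++ t :: ~~ t :: v) (map b (s i j)) /\
    ~ pattern phi (u ++ ~~ t :: t :: v) (map b (s i j)).
  move=> ui ij jl; apply: b_ord.
  - rewrite (sorted_pairwise ltn_trans) pairwise_cat /= -!(sorted_pairwise ltn_trans).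
    rewrite !iota_ltn_sorted !andbT ij /=; apply/and3P; split.
    + by apply/allrelP => x y; rewrite !inE !mem_iota; lia.
    + by apply/allP => x; rewrite mem_iota /=; lia.
    + by apply/allP => x; rewrite mem_iota /=; lia.
  - by apply/allP => x; rewrite mem_cat !inE !mem_iota /=; lia.
  - by rewrite size_cat /= !size_iota.
have sE i j : map b (s i j) = map b (iota 0 (size u)) ++
    b i :: b j :: map b (iota (l - size v) (size v)) by rewrite map_cat.
have R_lt i : (size u <= i)%N -> (i < k.-1)%N -> R (b i).
  by move=> ui ik; rewrite /R -sE; apply: (s_ord _ _ ui ik _).1; lia.
(* If [R (b i)] held, exchanging [b i] with the pivot would realize the forbidden pattern on an
   increasing tuple. *)
have R_gt i : (k.-1 < i)%N -> (i < l - size v)%N -> ~ R (b i).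
  move=> ki il; have [|_ nR] := s_ord _ _ _ ki il; first by lia.
  move=> Ri; apply: nR; rewrite sE.
  by apply: pattern_swap Ri; rewrite size_map size_iota.
(* [R] is not controlled at the outer terms and at the pivot: the last ones are removed by hand, the
   first ones and the pivot are added. *)
pose last_v := [set y | exists2 i, (l - size v <= i < l)%N & y = b i].
pose first_u := [set y | exists2 i, (i < size u)%N || (i == k.-1) & y = b i].
exists [set y | R y /\ ~ last_v y], first_u; split.
- exists [set y | R y], last_v; split=> //.
    exists z; split.
      move=> [i|[[]|i]]; [exists i|exists k.-1|exists (l - size v + i)] => //=.
      + by have := ltn_ord i; lia.
      + by lia.
      + by have := ltn_ord i; lia.
    by move=> y _; rewrite zR.
  apply: (small_trace_below (s := iota (l - size v) (size v)) b_inj).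
  + by rewrite size_iota.
  + by apply/allP => i; rewrite mem_iota /=; lia.
  + move=> i il; rewrite mem_iota; split=> [[j jl /b_inj ->]|il']; try lia.
    by exists i => //; lia.
- apply: (small_trace_below (s := k.-1 :: iota 0 (size u)) b_inj).
  + by rewrite /= size_iota.
  + by apply/allP => i; rewrite inE mem_iota /=; lia.
  + move=> i il; rewrite inE mem_iota; split=> [[j ju /b_inj ->]|il']; try lia.
    by exists i => //; lia.
move=> _ [i /= il <-]; rewrite Xk //; split=> [ik|[[Ri nlast]|[j ju /b_inj ij]]].
- have [iu|] := boolP ((i < size u)%N || (i == k.-1)); first by right; exists i.
  rewrite negb_or => /andP[ui ik1]; left; split; first by apply: R_lt; lia.
  by move=> [j jl /b_inj ij]; lia.
- apply: contrapT => /negP ik; apply: (R_gt i) Ri; first by lia.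
  rewrite ltnNge; apply/negP => li; apply: nlast; exists i => //; lia.
- by rewrite ij; lia.
Qed.

Definition alternating_trace (u v : seq bool) (t : bool) (M : nat) : family C n :=
  fun B X => exists l b ks, [/\ inj_below l b, orders u v t l b, B = b @` `I_l,
    size ks = M & forall i, (i < l)%N -> X (b i) <-> odd (count (leq^~ i) ks)].

(** The set is a symmetric difference of [M] final segments, each the complement of an initial
    one. *)
Lemma unif_def_alternating (u v : seq bool) (t : bool) (M : nat) :
  unif_def (alternating_trace u v t M).
Proof.
elim: M => [|M IH].
  apply: unif_def_sub (unif_def_set0 C n) => B X [l [b [ks [_ _ -> /size0nil -> XE]]]].
  by move=> _ [i il <-] /(XE i il).
apply: unif_def_sub (unif_def_xor (unif_def_not (unif_def_initial u v t)) IH).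
move=> B X [l [b [ks' [b_inj b_ord -> sM XE]]]].
case: ks' sM XE => // k ks [sM] XE.
pose cut (P : pred nat) := [set y | exists i, [/\ (i < l)%N, P i & y = b i]].
have cutE P i : (i < l)%N -> cut P (b i) <-> P i.
  by move=> il; split=> [[j [jl Pj /b_inj ->]]|Pi] //; exists i.
exists (cut (leq k)), (cut (fun i => odd (count (leq^~ i) ks))); split.
- exists l, b, k; split=> // i il; rewrite /setC /= cutE //.
  by rewrite ltnNge; split=> /negP.
- by exists l, b, ks; split=> // i il; rewrite cutE.
move=> _ [i il <-]; rewrite XE // !cutE //= oddD oddb.
case: (k <= i)%N; case: (odd _) => /=; split=> //; try (by case=> -[]).
  by left.
by right.
Qed.

Definition pattern_indisc (l : nat) (b : nat -> tup) :=
  forall w s s', sorted ltn s -> sorted ltn s' -> all (gtn l) s ->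
    all (gtn l) s' -> size s = size s' ->
    pattern phi w (map b s) -> pattern phi w (map b s').

Lemma pattern_indisc_shattered (l : nat) (b : nat -> tup) (N : nat) (s : seq nat) :
  pattern_indisc l b -> sorted ltn s -> all (gtn l) s -> size s = N ->
  (forall w, size w = N -> exists s', [/\ sorted ltn s', all (gtn l) s',
    size s' = N & pattern phi w (map b s')]) ->
  shattered phi (fun i : 'I_N => b (nth 0 s i)).
Proof.
move=> b_ind ss sl sN allw tau.
have [|s' [ss' sl' sN' pw]] := allw (map tau (enum 'I_N)).
  by rewrite size_map size_enum_ord.
have [a Ha] := b_ind _ _ _ ss' ss sl' sl (etrans sN' (esym sN)) pw.
exists a => i; have := congr1 (fun r => nth false r i) Ha.
by rewrite nth_map_enum (nth_map (b 0)) ?size_map ?sN // (nth_map 0) ?sN.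
Qed.

(** If no exchange destroyed realizability, every word with [N] values of each kind would be
    realized on [s]; since any word of length [N] begins such a word, the first [N] terms would be
    shattered. *)
Lemma ex_orders (l : nat) (b : nat -> tup) (N : nat) (w : seq bool) (s : seq nat) :
  (forall f : 'I_N -> tup, ~ shattered phi f) -> pattern_indisc l b ->
  sorted ltn s -> all (gtn l) s -> count id w = N -> count negb w = N ->
  pattern phi w (map b s) ->
  exists u v t, size u + (size v).+2 = N.*2 /\ orders u v t l b.
Proof.
move=> noN b_ind ss sl wT wF pw; apply: contrapT => no_order.
have sN : size s = N.*2.
  rewrite -(size_map b s) -(pattern_size pw) -(count_predC id w) wT.
  by rewrite (eq_count (a2 := negb)) // wF addnn.
pose S w' := pattern phi w' (map b s).
have S_swap u v t : S (u ++ t :: ~~ t :: v) -> S (u ++ ~~ t :: t :: v).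
  move=> Sw; apply: contrapT => nS; apply: no_order; exists u, v, t.
  have sz := pattern_size Sw; rewrite size_cat size_map sN /= in sz.
  split=> // s' ss' sl' sz'.
  have es : size s = size s' by rewrite sN sz' -sz.
  split; first exact: b_ind Sw.
  by move=> /(b_ind _ _ _ ss' ss sl' sl (esym es)).
apply: (noN (fun i => b (nth 0 (take N s) i))).
apply: (pattern_indisc_shattered b_ind).
- exact: take_sorted.
- by apply/allP => x /mem_take; apply: (allP sl).
- by rewrite size_takel // sN -addnn leq_addr.
move=> w' w'N; exists (take N s); split.
- exact: take_sorted.
- by apply/allP => x /mem_take; apply: (allP sl).
- by rewrite size_takel // sN -addnn leq_addr.
(* Appending the negation of [w'] balances the two values. *)
have [a Ha] : S (w' ++ map negb w').
  apply: (@swap_count S S_swap w) pw.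
    rewrite wT count_cat count_map -w'N -(count_predC id w'); congr (_ + _).
  rewrite wF count_cat count_map addnC -w'N -(count_predC id w').
  by congr (_ + _); apply: eq_count => -[].
exists a; rewrite map_take map_take Ha take_size_cat //.
Qed.

(** Among [2N] switches, each of the [N] consecutive pairs shows both truth values. One choice per
    pair produces any word of length [N] on an increasing tuple, and [N] terms would be
    shattered. *)
Lemma few_switches (l : nat) (b : nat -> tup) (N : nat) (tau : nat -> bool) :
  (forall f : 'I_N -> tup, ~ shattered phi f) -> pattern_indisc l b ->
  (forall s, pattern phi (map tau s) (map b s)) ->
  (size (switches tau l) < N.*2)%N.
Proof.
move=> noN b_ind btau; rewrite ltnNge; apply/negP => Nks.
set ks := switches tau l in Nks.
have ks_lt i j : (i < j)%N -> (j < size ks)%N -> (nth 0 ks i < nth 0 ks j)%N.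
  move=> ij js; have := switches_sorted tau l; rewrite (sorted_pairwise ltn_trans).
  by move/(pairwiseP 0); apply=> //; apply: ltn_trans ij js.
have kl i : (i < size ks)%N -> (nth 0 ks i < l)%N.
  by move=> /(mem_nth 0); apply: (allP (switches_lt tau l)).
have sub (f : nat -> nat) : (forall i, (i < N)%N -> (i.*2 <= f i < i.+1.*2)%N) ->
    sorted ltn [seq nth 0 ks (f i) | i <- iota 0 N] /\
    all (gtn l) [seq nth 0 ks (f i) | i <- iota 0 N].
  move=> fP; split.
    rewrite (sorted_pairwise ltn_trans); apply/(pairwiseP 0) => i j.
    rewrite !inE !size_map size_iota => iN jN ij.
    rewrite !(nth_map 0) ?size_iota // !nth_iota // !add0n; apply: ks_lt.
      by have := fP i iN; have := fP j jN; lia.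
    by have := fP j jN; lia.
  apply/allP => x /mapP[i]; rewrite mem_iota => /= iN ->; apply: kl.
  by have := fP i iN; lia.
have [|ss sl] := sub double; first by move=> i _; lia.
apply: (noN _ (pattern_indisc_shattered b_ind ss sl _ _)).
  by rewrite size_map size_iota.
move=> w wN.
(* The even member of the pair is taken if its value is right, the odd one otherwise. *)
pose f i := i.*2 + (tau (nth 0 ks i.*2) != nth false w i).
have fP i : (i < N)%N -> (i.*2 <= f i < i.+1.*2)%N.
  by move=> _; rewrite /f; case: (_ != _); lia.
have [ss' sl'] := sub f fP.
exists [seq nth 0 ks (f i) | i <- iota 0 N]; split=> //.
  by rewrite size_map size_iota.
suff <- : map tau [seq nth 0 ks (f i) | i <- iota 0 N] = w by apply: btau.
apply: (@eq_from_nth _ false); rewrite !size_map size_iota ?wN // => i iN.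
rewrite (nth_map 0) ?size_map ?size_iota // (nth_map 0) ?size_iota // nth_iota // add0n.
have alt j : (j < size ks)%N -> tau (nth 0 ks j) = tau 0 (+) ~~ odd j.
  exact: switches_alternate.
have := fP i iN => fi; rewrite (alt (f i)); last by lia.
rewrite /f (alt i.*2); last by lia.
rewrite oddD odd_double oddb /=.
by case: (tau 0); case: (nth false w i).
Qed.

(** The index [x] stores the word [u ++ t :: ~~ t :: v], the position of [t] in it and the number of
    switches. It ranges over a finite type, as [unif_def_exists] requires. *)
Definition dependent_trace (N : nat) : family C n := fun B X =>
  exists x : (N.*2).-tuple bool * 'I_N.*2 * 'I_N.*2,
    let u := take x.1.2 x.1.1 in
    let v := drop x.1.2.+2 x.1.1 in
    let t := nth false x.1.1 x.1.2 in
    alternating_trace u v t x.2 B X \/ alternating_trace u v t x.2 B (~` X).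

Lemma dependent_traces (N l : nat) (b : nat -> tup) (tau : nat -> bool) (X : set tup) :
  (forall f : 'I_N -> tup, ~ shattered phi f) -> inj_below l b ->
  pattern_indisc l b -> (forall s, pattern phi (map tau s) (map b s)) ->
  (forall i, (i < l)%N -> X (b i) <-> tau i) ->
  let B := b @` `I_l in
  (small_trace N B X \/ small_trace N B (~` X)) \/ dependent_trace N B X.
Proof.
move=> noN b_inj b_ind btau Xtau B.
have few (P : pred nat) Y s : (forall i, (i < l)%N -> Y (b i) <-> P i) ->
    (size s <= N)%N -> all (fun i => (i < l)%N && P i) s ->
    (forall i, (i < l)%N && P i -> i \in s) -> small_trace N B Y.
  move=> YP sN sP Ps; apply: (small_trace_below b_inj sN).
    by apply: sub_all sP => i /andP[].
  move=> i il; rewrite YP //; split=> [Pi|/(allP sP)/andP[]//].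
  by apply: Ps; rewrite il.
have [[s1 [u1 z1 a1]]|[s [sM sP Ps]]] :=
  many_or_few (fun i => (i < l)%N && tau i) N; last by left; left; apply: few sM sP Ps.
have [[s2 [u2 z2 a2]]|[s [sM sP Ps]]] :=
  many_or_few (fun i => (i < l)%N && ~~ tau i) N; last first.
  left; right; apply: (few (fun i => ~~ tau i)) sM sP Ps => i il.
  by rewrite /setC /= Xtau //; split=> /negP.
right; pose s := sort leq (s1 ++ s2).
have cnt (P : pred nat) : count P s = count P s1 + count P s2.
  by rewrite -count_cat; apply/permP; rewrite perm_sort.
have tau1 i : i \in s1 -> tau i by move=> /(allP a1)/andP[].
have tau2 i : i \in s2 -> ~~ tau i by move=> /(allP a2)/andP[].
have ss : sorted ltn s.
  rewrite ltn_sorted_uniq_leq sort_sorted ?andbT; last exact: leq_total.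
  rewrite sort_uniq cat_uniq u1 u2 andbT /=; apply/hasPn => i /tau2.
  by apply: contra => /tau1.
have sl : all (gtn l) s.
  rewrite all_sort all_cat; apply/andP; split.
    by apply: sub_all a1 => i /andP[].
  by apply: sub_all a2 => i /andP[].
have [||u [v [t [uvN uvt]]]] := ex_orders noN b_ind ss sl _ _ (btau s).
- rewrite count_map cnt (eq_in_count (a2 := predT)) => [|i /tau1 /= -> //].
  rewrite count_predT z1 [X in _ + X](eq_in_count (a2 := pred0)) ?count_pred0 ?addn0 //.
  by move=> i /tau2/negbTE.
- rewrite count_map cnt (eq_in_count (a2 := pred0)) => [|i /tau1 /= -> //].
  rewrite count_pred0 add0n (eq_in_count (a2 := predT)) ?count_predT //.
have sks := few_switches noN b_ind btau.
have zw : size (u ++ t :: ~~ t :: v) == N.*2 by rewrite size_cat /= uvN.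
have ul : (size u < N.*2)%N by lia.
exists (Tuple zw, Ordinal ul, Ordinal sks) => /=.
rewrite take_size_cat // nth_cat ltnn subnn /=.
have -> : drop (size u).+2 (u ++ t :: ~~ t :: v) = v.
  by rewrite -(add2n (size u)) -drop_drop drop_size_cat //= drop0.
have par := @switches_parity tau l.
(* The parity of switches gives [tau] itself if [tau 0] is false, and its complement otherwise. *)
case tau0 : (tau 0) par => par; [right|left];
  exists l, b, (switches tau l); split=> // i il.
  by rewrite /setC /= Xtau // par // addTb; case: (odd _); split=> // /(_ isT).
by rewrite Xtau // par.
Qed.

Lemma definitions_of_dependent : dependent C phi ->
  exists (K : nat) (psi : formula L ('I_n + 'I_K * 'I_n)),
    forall (l : nat) (b : 'I_l -> 'I_n -> C),
      injective b -> indiscernible b -> (2 <= l)%N ->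
      forall p : set (formula L ('I_m + C)), phi_type phi (range b) p ->
        exists i : 'I_K -> 'I_l,
          defines phi (inst psi (fun w => b (i w.1) w.2)) (range b) p.
Proof.
move=> /shattered_dependent[N noN].
have dN := unif_def_small C n N.
have dalt : unif_def (dependent_trace N).
  apply: unif_def_exists => x; have dx := unif_def_alternating.
  by apply: unif_def_or; [|apply: unif_def_not]; apply: dx.
have [K [psi psiP]] :=
  unif_def_formula (unif_def_or (unif_def_or dN (unif_def_not dN)) dalt).
exists K, psi => l b b_inj b_indisc l2 p p_type.
pose i0 : 'I_l := Ordinal (ltnW l2); pose i1 : 'I_l := Ordinal l2.
(* The finite sequence is extended to all of [nat] by its first term; only indices below [l] matter
   afterwards. *)
pose e j := b (insubd i0 j).
have ins j : (j < l)%N -> val (insubd i0 j) = j by move=> jl; rewrite val_insubd jl.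
have e_range : e @` `I_l = range b.
  apply/seteqP; split=> [_ [j _ <-]|_ [i _ <-]]; first by exists (insubd i0 j).
  by exists i; rewrite /e ?valKd //=.
have ins_sorted s : sorted ltn s -> all (gtn l) s -> sorted <%O (map (insubd i0) s).
  move=> ss sl; suff : sorted ltn (map val (map (insubd i0) s)) by rewrite sorted_map.
  by rewrite -map_comp map_id_in // => j /(allP sl); apply: ins.
apply: psiP; first by exists i0, i1 => /b_inj.
rewrite -e_range.
apply: (dependent_traces (tau := fun j => `[< p (inst phi (e j)) >]) noN).
- by move=> i j il jl /b_inj/(congr1 val); rewrite !ins.
- move=> w s s' ss ss' sl sl' ez.
  have mapE r : map e r = map b (map (insubd i0) r) by rewrite -map_comp.
  rewrite !mapE => pw.
  apply/(indisc_pattern phi b_indisc w (ins_sorted s ss sl)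
    (ins_sorted s' ss' sl')) => //.
  by rewrite !size_map.
- move=> s; have := phi_type_pattern (map (insubd i0) s) p_type.
  by rewrite -!map_comp.
- by move=> i il; split=> /asboolP.
Qed.

End Dependent.

Theorem theorem1p2 (L : language) (T : theory L) (kappa : Type)
    (C : structure L) (m n : nat) (phi : formula L ('I_m + 'I_n))
    (complete_T : complete T) (monster_C : monster T kappa C) :
  (stable C phi <->
    exists (K : nat) (psi : formula L ('I_n + 'I_K * 'I_n)),
      forall (d : Order.disp_t) (I : orderType d) (b : I -> 'I_n -> C),
        small kappa (range b) -> injective b -> indiscernible b ->
        (exists i j : I, i <> j) ->
        forall p : set (formula L ('I_m + C)), phi_type phi (range b) p ->
          exists i : 'I_K -> I,
            defines phi (inst psi (fun w => b (i w.1) w.2)) (range b) p)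
  /\
  (dependent C phi <->
    exists (K : nat) (psi : formula L ('I_n + 'I_K * 'I_n)),
      forall (l : nat) (b : 'I_l -> 'I_n -> C),
        injective b -> indiscernible b -> (2 <= l)%N ->
        forall p : set (formula L ('I_m + C)), phi_type phi (range b) p ->
          exists i : 'I_K -> 'I_l,
            defines phi (inst psi (fun w => b (i w.1) w.2)) (range b) p).
Proof.
have [kappa_uncountable _ C_saturated _] := monster_C.
split; split.
- exact: (definitions_of_stable kappa_uncountable C_saturated).
- exact: (stable_of_definitions kappa_uncountable C_saturated).
- exact: definitions_of_dependent.
- exact: (dependent_of_definitions kappa_uncountable C_saturated).
Qed.
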